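(* Let the sample covariance matrix $\mathbf{S} = (s_{ij})$ be computed on an i.i.d. random sample $\mathbf{x}_1,\ldots,\mathbf{x}_n \in \mathbb{C}^p$ from a complex elliptically symmetric (CES) distribution $\mathbb{C}\mathcal{E}_p(\boldsymbol{\mu},\boldsymbol{\Sigma},g)$ with finite fourth-order moments and covariance matrix $\boldsymbol{\Sigma} = \mathrm{var}(\mathbf{x}_i)$. Then the covariance matrix and pseudo-covariance matrix of $\mathbf{S}$ are $$\mathrm{var}(\mathbf{S}) = \tau_1 (\boldsymbol{\Sigma}^* \otimes \boldsymbol{\Sigma}) + \tau_2\, \mathrm{vec}(\boldsymbol{\Sigma})\mathrm{vec}(\boldsymbol{\Sigma})^{\mathsf{H}},$$ $$\mathrm{pvar}(\mathbf{S}) = \tau_1 (\boldsymbol{\Sigma}^* \otimes \boldsymbol{\Sigma})\mathbf{K}_{p,p} + \tau_2\, \mathrm{vec}(\boldsymbol{\Sigma})\mathrm{vec}(\boldsymbol{\Sigma})^{\top},$$ with $$\tau_1 = \mathrm{var}_{\mathbf{0},\mathbf{I}}(s_{12}) = \frac{1}{n-1} + \frac{\kappa}{n}, \qquad \tau_2 = \mathrm{cov}_{\mathbf{0},\mathbf{I}}(s_{11}, s_{22}) = \frac{\kappa}{n},$$ where $\kappa$ is the elliptical kurtosis. The mean squared error is $$\mathrm{MSE}(\mathbf{S}) = \mathbb{E}\big[\|\mathbf{S}-\boldsymbol{\Sigma}\|_{\mathrm{F}}^2\big] = \Big(\frac{1}{n-1}+\frac{\kappa}{n}\Big)\mathrm{tr}(\boldsymbol{\Sigma})^2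 + \frac{\kappa}{n}\mathrm{tr}(\boldsymbol{\Sigma}^2),$$ and the normalized mean squared error is $$\mathrm{NMSE}(\mathbf{S}) = \frac{\mathrm{MSE}(\mathbf{S})}{\|\boldsymbol{\Sigma}\|_{\mathrm{F}}^2} = \frac{p}{\gamma}\Big(\frac{1}{n-1}+\frac{\kappa}{n}\Big) + \frac{\kappa}{n},$$ where $\gamma = p\,\mathrm{tr}(\boldsymbol{\Sigma}^2)/\mathrm{tr}(\boldsymbol{\Sigma})^2$ is the sphericity parameter.
   Context: Notation: $(\cdot)^*$, $(\cdot)^\top$, $(\cdot)^{\mathsf{H}}$ denote the complex conjugate, the transpose and the conjugate transpose; $\|\cdot\|_{\mathrm{F}}$ is the Frobenius norm. $\mathbf{I}$ is the identity matrix, $\mathbf{e}_i$ the $i$th standard basis vector. For a matrix $\mathbf{A} = (\mathbf{a}_1 \cdots \mathbf{a}_p)$ with columns $\mathbf{a}_i$, $\mathrm{vec}(\mathbf{A}) = (\mathbf{a}_1^\top \cdots \mathbf{a}_p^\top)^\top$. $\otimes$ is the Kronecker product, and $\mathbf{K}_{p,p} = \sum_{i,j=1}^p \mathbf{e}_i\mathbf{e}_j^\top \otimes \mathbf{e}_j\mathbf{e}_i^\top$ is the $p^2\times p^2$ commutation matrix. For complex random vectors (or scalars) $\mathbf{x}_1,\mathbf{x}_2$ with finite second-order moments, $\mathrm{cov}(\mathbf{x}_1,\mathbf{x}_2) = \mathbb{E}[(\mathbf{x}_1-\mathbb{E}[\mathbf{x}_1])(\mathbf{x}_2-\mathbb{E}[\mathbf{x}_2])^{\mathsf{H}}]$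 and $\mathrm{pcov}(\mathbf{x}_1,\mathbf{x}_2) = \mathbb{E}[(\mathbf{x}_1-\mathbb{E}[\mathbf{x}_1])(\mathbf{x}_2-\mathbb{E}[\mathbf{x}_2])^{\top}]$; moreover $\mathrm{var}(\mathbf{x}) = \mathrm{cov}(\mathbf{x},\mathbf{x})$ and $\mathrm{pvar}(\mathbf{x}) = \mathrm{pcov}(\mathbf{x},\mathbf{x})$. For a random matrix $\mathbf{A}$, $\mathrm{var}(\mathbf{A}) = \mathrm{var}(\mathrm{vec}(\mathbf{A}))$ and $\mathrm{pvar}(\mathbf{A}) = \mathrm{pvar}(\mathrm{vec}(\mathbf{A}))$. The (unbiased) sample covariance matrix is $\mathbf{S} = \frac{1}{n-1}\sum_{i=1}^n (\mathbf{x}_i-\bar{\mathbf{x}})(\mathbf{x}_i-\bar{\mathbf{x}})^{\mathsf{H}}$ with $\bar{\mathbf{x}} = \frac1n\sum_{i=1}^n\mathbf{x}_i$ (the division by $n-1$ means that $n\geq 2$). CES distributions: a random vector $\mathbf{x}\in\mathbb{C}^p$ has a (circular) CES distribution if and only if it has the same distribution as $\boldsymbol{\mu} + r\,\boldsymbol{\Sigma}^{1/2}\mathbf{u}$, where $\boldsymbol{\mu} = \mathbb{E}[\mathbf{x}]$, $\boldsymbol{\Sigma}$ is a Hermitian positive definite $p\times p$ matrix with unique Hermitian positive definite square root $\boldsymbol{\Sigma}^{1/2}$, $\mathbf{u}$ is uniformly distributed on the complex unit sphere $\{\mathbf{u}\in\mathbb{C}^p : \|\mathbf{u}\| = 1\}$,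 and $r>0$ is a positive random variable (the modular variate) independent of $\mathbf{u}$. One writes $\mathbf{x}\sim\mathbb{C}\mathcal{E}_p(\boldsymbol{\mu},\boldsymbol{\Sigma},g)$ when the distribution is absolutely continuous, with density equal, up to a constant, to $|\boldsymbol{\Sigma}|^{-1} g\big((\mathbf{x}-\boldsymbol{\mu})^{\mathsf{H}}\boldsymbol{\Sigma}^{-1}(\mathbf{x}-\boldsymbol{\mu})\big)$, where $g:\mathbb{R}_{\geq 0}\to\mathbb{R}_{>0}$ is the density generator. The normalization is such that $\boldsymbol{\Sigma} = \mathrm{var}(\mathbf{x})$ (so that $\mathbb{E}[r^2] = p$). The elliptical kurtosis is $\kappa = \frac{\mathbb{E}[r^4]}{p(p+1)} - 1$. The subscript $\mathbf{0},\mathbf{I}$ in $\mathrm{var}_{\mathbf{0},\mathbf{I}}$, $\mathrm{cov}_{\mathbf{0},\mathbf{I}}$ means that the quantity is computed when $\mathbf{S}$ is based on an i.i.d. sample of size $n$ from the spherical distribution $\mathbb{C}\mathcal{E}_p(\mathbf{0},\mathbf{I},g)$ with the same density generator $g$ (hence the same distribution of $r$); unsubscripted quantities are computed under $\mathbb{C}\mathcal{E}_p(\boldsymbol{\mu},\boldsymbol{\Sigma},g)$. *)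

(* Defs.v *)
From HB Require Import structures.
From mathcomp Require Import all_boot all_order all_algebra.
From mathcomp Require Import sesquilinear spectral.
From mathcomp Require Import all_classical all_reals all_analysis.
From mathcomp Require Import complex mxtens.

Set Implicit Arguments.
Unset Strict Implicit.
Unset Printing Implicit Defensive.

Import Order.TTheory GRing.Theory Num.Theory.
Import numFieldNormedType.Exports.
Import ComplexField.Normc.

Local Open Scope classical_set_scope.
Local Open Scope ring_scope.
Local Open Scope sesquilinear_scope.
Local Open Scope complex_scope.

Section measurable_complex.
Context {R : realType}.

HB.instance Definition _ := isPointed.Build R[i] 0.

Definition complex_borel : set (set R[i]) :=
  g_sigma_preimageU (@complex.Re R) (@complex.Im R).

Let borel0 : complex_borel set0.
Proof. exact: sigma_algebra0. Qed.

Let borelC A : complex_borel A -> complex_borel (~` A).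
Proof. exact: sigma_algebraC. Qed.

Let borelU (F : (set R[i])^nat) : (forall k, complex_borel (F k)) ->
  complex_borel (\bigcup_k F k).
Proof. exact: sigma_algebra_bigcup. Qed.

HB.instance Definition _ := @isMeasurable.Build (sigma_display complex_borel)
  R[i] complex_borel borel0 borelC borelU.

Lemma measurable_Re : measurable_fun [set: R[i]] (@complex.Re R).
Proof.
move=> _ A mA; rewrite setTI; apply: sub_sigma_algebra; left.
by exists A => //; rewrite setTI.
Qed.

Lemma measurable_Im : measurable_fun [set: R[i]] (@complex.Im R).
Proof.
move=> _ A mA; rewrite setTI; apply: sub_sigma_algebra; right.
by exists A => //; rewrite setTI.
Qed.

Lemma measurable_Complex :
  measurable_fun [set: R * R] (fun ab => ab.1 +i* ab.2).
Proof.
apply: measurability => //.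
move=> _ [_ [[A mA <-]|[A mA <-]] <-]; rewrite !setTI.
- by rewrite -[X in measurable X]setTI; exact: measurable_fst.
- by rewrite -[X in measurable X]setTI; exact: measurable_snd.
Qed.

End measurable_complex.

Section measurable_matrix.
Context {d} {T : measurableType d} (m n : nat).

Definition matrix_cylinder : set (set 'M[T]_(m, n)) :=
  \bigcup_(ij in [set: 'I_m * 'I_n])
    preimage_set_system setT (fun A : 'M[T]_(m, n) => A ij.1 ij.2) measurable.

HB.instance Definition _ :=
  isPointed.Build 'M[T]_(m, n) (const_mx (point : T)).

Let cylinder0 : <<s matrix_cylinder >> set0.
Proof. exact: sigma_algebra0. Qed.

Let cylinderC A : <<s matrix_cylinder >> A -> <<s matrix_cylinder >> (~` A).
Proof. exact: sigma_algebraC. Qed.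

Let cylinderU (F : (set 'M[T]_(m, n))^nat) :
  (forall k, <<s matrix_cylinder >> (F k)) ->
  <<s matrix_cylinder >> (\bigcup_k F k).
Proof. exact: sigma_algebra_bigcup. Qed.

HB.instance Definition _ := @isMeasurable.Build (sigma_display matrix_cylinder)
  'M[T]_(m, n) <<s matrix_cylinder >> cylinder0 cylinderC cylinderU.

Lemma measurable_coord i j :
  measurable_fun [set: 'M[T]_(m, n)] (fun A : 'M[T]_(m, n) => A i j).
Proof.
move=> _ B mB; rewrite setTI; apply: sub_sigma_algebra; exists (i, j) => //.
by exists B => //; rewrite setTI.
Qed.

Lemma measurable_fun_matrix d' (U : measurableType d') (f : U -> 'M[T]_(m, n)) :
  (forall i j, measurable_fun [set: U] (fun x => f x i j)) ->
  measurable_fun [set: U] f.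
Proof.
move=> mf; apply: (@measurability _ _ _ _ _ _ matrix_cylinder) => //.
move=> _ [_ [[i j] _ [B mB <-]] <-]; rewrite !setTI.
by have := mf i j measurableT _ mB; rewrite setTI.
Qed.

End measurable_matrix.

Section product_image.
Local Open Scope ereal_scope.
Context d1 d2 d3 (T1 : measurableType d1) (T2 : measurableType d2)
  (T3 : measurableType d3) (R : realType).
Variables (m1 : {sigma_finite_measure set T1 -> \bar R}).
Variables (m2 : {sigma_finite_measure set T2 -> \bar R}).
Variables (f : T1 * T2 -> T3) (g : T3 -> T1 * T2).

(* The last three arguments only serve to equip the image of m1 \x m2 under f
   with the structure of a sigma-finite measure. *)
Definition product_image of measurable_fun setT f & measurable_fun setT g
  & cancel f g : set T3 -> \bar R := pushforward (m1 \x m2) f.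

Hypotheses (mf : measurable_fun setT f) (mg : measurable_fun setT g).
Hypothesis fK : cancel f g.
Let nu := product_image mf mg fK.

Let mfpre A : measurable A -> measurable (f @^-1` A).
Proof. by move=> mA; rewrite -[X in measurable X]setTI; exact: mf. Qed.

Let nu0 : nu set0 = 0.
Proof. by rewrite /nu /product_image /pushforward preimage_set0 measure0. Qed.

Let nu_ge0 A : 0 <= nu A.
Proof. exact: (measure_ge0 (m1 \x m2)). Qed.

Let nu_sigma_additive : semi_sigma_additive nu.
Proof.
move=> F mF tF mUF; rewrite /nu /product_image /pushforward preimage_bigcup.
apply: measure_semi_sigma_additive.
- by move=> k; exact: mfpre.
- apply/trivIsetP => /= i j _ _ ij; rewrite -preimage_setI.
  by move/trivIsetP : tF => /(_ _ _ _ _ ij) ->//; rewrite preimage_set0.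
- by rewrite -preimage_bigcup; exact: mfpre.
Qed.

HB.instance Definition _ := isMeasure.Build _ _ _ (product_image mf mg fK)
  nu0 nu_ge0 nu_sigma_additive.

Let nu_sigma_finite : sigma_finite setT (product_image mf mg fK).
Proof.
have /sigma_finiteP[F [TF ndF Foo]] := sigma_finiteT m1.
have /sigma_finiteP[G [TG ndG Goo]] := sigma_finiteT m2.
exists (fun n => g @^-1` (F n `*` G n)).
  rewrite -preimage_bigcup -[LHS](preimage_setT g); congr (_ @^-1` _).
  rewrite -setXTT TF TG predeqE => -[x y]; split.
    move=> [/= [n _ Fnx] [k _ Gky]]; exists (maxn n k) => //; split.
    - by move: x Fnx; exact/subsetPset/ndF/leq_maxl.
    - by move: y Gky; exact/subsetPset/ndG/leq_maxr.
  by move=> [n _ []/= ? ?]; split; exists n.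
move=> k; have [? ?] := Foo k; have [? ?] := Goo k; split.
  by rewrite -[X in measurable X]setTI; apply: mg => //; exact: measurableX.
rewrite /product_image /pushforward -comp_preimage (_ : g \o f = id).
  by rewrite preimage_id product_measure1E// lte_mul_pinfty// ge0_fin_numE.
by apply/funext => x /=; rewrite fK.
Qed.

HB.instance Definition _ := Measure_isSigmaFinite.Build _ _ _
  (product_image mf mg fK) nu_sigma_finite.

End product_image.

Section lebesgue_complex.
Context (R : realType).

Lemma measurable_ReIm :
  measurable_fun [set: R[i]]
    (fun z => (complex.Re z, complex.Im z)
      : measurableTypeR R * measurableTypeR R).
Proof.
apply/measurable_fun_pairP.
by split; [exact: measurable_Re|exact: measurable_Im].
Qed.

Lemma ReImK : cancel (fun ab : R * R => ab.1 +i* ab.2)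
                     (fun z => (complex.Re z, complex.Im z)).
Proof. by case. Qed.

Definition lebesgueC : {sigma_finite_measure set R[i] -> \bar R} :=
  product_image (@lebesgue_measure R) (@lebesgue_measure R)
    measurable_Complex measurable_ReIm ReImK.

Definition cons_cV p (az : R[i] * 'cV[R[i]]_p) : 'cV[R[i]]_p.+1 :=
  col_mx (az.1%:M : 'cV_1) az.2.

Definition uncons_cV p (z : 'cV[R[i]]_p.+1) : R[i] * 'cV[R[i]]_p :=
  (z 0 0, dsubmx (z : 'cV_(1 + p))).

Lemma measurable_cons_cV p : measurable_fun setT (@cons_cV p).
Proof.
apply: measurable_fun_matrix => i j.
have [k ->|k ->] := split_ordP (i : 'I_(1 + p)).
  rewrite (_ : (fun _ => _) = fst); first exact: measurable_fst.
  by apply/funext => az; rewrite [LHS]col_mxEu !ord1 mxE.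
rewrite (_ : (fun _ => _) = (fun z : 'cV[R[i]]_p => z k j) \o snd).
  by apply: measurableT_comp; [exact: measurable_coord|exact: measurable_snd].
by apply/funext => az; rewrite [LHS]col_mxEd.
Qed.

Lemma measurable_uncons_cV p : measurable_fun setT (@uncons_cV p).
Proof.
apply/measurable_fun_pairP; split; first exact: measurable_coord.
apply: measurable_fun_matrix => i j.
rewrite (_ : (fun _ => _) = (fun z : 'cV[R[i]]_(1 + p) => z (rshift 1 i) j)).
  exact: measurable_coord.
by apply/funext => z /=; rewrite mxE.
Qed.

Lemma cons_cVK p : cancel (@cons_cV p) (@uncons_cV p).
Proof.
move=> [a z]; rewrite /uncons_cV /cons_cV /= col_mxKd; congr pair.
have -> : 0 = lshift p 0 :> 'I_(1 + p) by exact/val_inj.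
by rewrite [LHS]col_mxEu mxE eqxx mulr1n.
Qed.

(* Lebesgue measure on C^p identified with R^(2p), as an iterated product. *)
Fixpoint lebesgueCn p : {sigma_finite_measure set 'cV[R[i]]_p -> \bar R} :=
  if p is p'.+1 then
    product_image lebesgueC (lebesgueCn p')
      (@measurable_cons_cV p') (@measurable_uncons_cV p') (@cons_cVK p')
  else \d_(0 : 'cV[R[i]]_0).

End lebesgue_complex.

Section moments.
Context d (T : measurableType d) (R : realType) (P : probability T R).

(* Junk value if the real or imaginary part is not integrable. *)
Definition expectC (X : T -> R[i]) : R[i] :=
  fine 'E_P[fun w => complex.Re (X w)] +i* fine 'E_P[fun w => complex.Im (X w)].

Definition covC (X Y : T -> R[i]) : R[i] :=
  expectC (fun w => (X w - expectC X) * Num.conj (Y w - expectC Y)).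

Definition varC (X : T -> R[i]) : R[i] := covC X X.

Definition expect_mx m n (X : T -> 'M[R[i]]_(m, n)) : 'M[R[i]]_(m, n) :=
  \matrix_(i, j) expectC (fun w => X w i j).

Definition cov_cV m n (X : T -> 'cV[R[i]]_m) (Y : T -> 'cV[R[i]]_n) :=
  expect_mx (fun w => (X w - expect_mx X) *m (Y w - expect_mx Y)^t*).

Definition pcov_cV m n (X : T -> 'cV[R[i]]_m) (Y : T -> 'cV[R[i]]_n) :=
  expect_mx (fun w => (X w - expect_mx X) *m (Y w - expect_mx Y)^T).

Definition var_cV m (X : T -> 'cV[R[i]]_m) := cov_cV X X.

Definition pvar_cV m (X : T -> 'cV[R[i]]_m) := pcov_cV X X.

End moments.

(* Column stacking: the entry A i j sits at position j * m + i, whereas mxvec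
   stacks rows. *)
Definition vec (C : Type) m n (A : 'M[C]_(m, n)) : 'cV[C]_(n * m) :=
  \col_k A (mxtens_unindex k).2 (mxtens_unindex k).1.

Definition var_mx d (T : measurableType d) (R : realType) (P : probability T R)
    m n (A : T -> 'M[R[i]]_(m, n)) := var_cV P (fun w => vec (A w)).

Definition pvar_mx d (T : measurableType d) (R : realType) (P : probability T R)
    m n (A : T -> 'M[R[i]]_(m, n)) := pvar_cV P (fun w => vec (A w)).

Definition commutation_mx (C : nzRingType) p : 'M[C]_(p * p) :=
  \sum_(i < p) \sum_(j < p)
    (delta_mx i j : 'M[C]_p) *t (delta_mx j i : 'M[C]_p).

Definition frobenius (R : realType) m n (A : 'M[R[i]]_(m, n)) : R :=
  Num.sqrt (\sum_i \sum_j normc (A i j) ^+ 2).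

Definition posdefmx (R : realType) p (A : 'M[R[i]]_p) : Prop :=
  A \is hermsymmx /\
  forall v : 'cV[R[i]]_p, v != 0 -> 0 < (v^t* *m A *m v) 0 0.

Section sample_covariance.
Context d (T : measurableType d) (R : realType) (n p : nat).
Variable x : 'I_n -> T -> 'cV[R[i]]_p.

Definition sample_mean (w : T) : 'cV[R[i]]_p := n%:R^-1 *: \sum_(i < n) x i w.

Definition sample_cov (w : T) : 'M[R[i]]_p :=
  (n.-1)%:R^-1 *:
  \sum_(i < n) (x i w - sample_mean w) *m (x i w - sample_mean w)^t*.

End sample_covariance.

Section distributions.
Context (R : realType).

(* Since some of the events B i may be the full space, the product rule for the
   whole family gives it for all subfamilies. *)
Definition mutually_independent d (T : measurableType d) (P : probability T R)
    d' (U : measurableType d') n (X : 'I_n -> {RV P >-> U}) : Prop :=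
  forall B : 'I_n -> set U, (forall i, measurable (B i)) ->
    P (\bigcap_(i in [set: 'I_n]) (X i @^-1` B i)) =
    (\prod_(i < n) P (X i @^-1` B i))%E.

Definition independent2 d (T : measurableType d) (P : probability T R)
    d1 (U1 : measurableType d1) d2 (U2 : measurableType d2)
    (X : {RV P >-> U1}) (Y : {RV P >-> U2}) : Prop :=
  forall (A : set U1) (B : set U2), measurable A -> measurable B ->
    P ((X @^-1` A) `&` (Y @^-1` B)) = (P (X @^-1` A) * P (Y @^-1` B))%E.

(* The uniform law on the sphere is its unique unitarily invariant
   probability. *)
Definition uniform_sphere d (T : measurableType d) (P : probability T R) p
    (u : {RV P >-> 'cV[R[i]]_p}) : Prop :=
  {ae P, forall w, frobenius (u w) = 1} /\
  forall (V : 'M[R[i]]_p) (B : set 'cV[R[i]]_p), V \is unitarymx ->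
    measurable B -> P [set w | B (V *m u w)] = P [set w | B (u w)].

Definition density_generator (g : R -> R) : Prop :=
  measurable_fun (`[0, +oo[%classic : set R) g /\ forall t, 0 <= t -> 0 < g t.

(* The law of x is CE_p(mu, Sigma, g), with modular variate (distributed as) r;
   r and u may live on another probability space than x. *)
Record ces d (T : measurableType d) (P : probability T R)
    d' (T' : measurableType d') (Q : probability T' R) p (r : {RV Q >-> R})
    (mu : 'cV[R[i]]_p) (Sigma : 'M[R[i]]_p) (g : R -> R)
    (x : {RV P >-> 'cV[R[i]]_p}) : Prop := Ces {
  ces_scatter : posdefmx Sigma;
  ces_modular : {ae Q, forall w, 0 < r w};
  ces_stochastic : exists (u : {RV Q >-> 'cV[R[i]]_p}) (A : 'M[R[i]]_p),
    [/\ uniform_sphere u, independent2 r u, posdefmx A, A *m A = Sigma &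
        forall B : set 'cV[R[i]]_p, measurable B ->
          P (x @^-1` B) = Q [set w | B (mu + (r w)%:C *: (A *m u w))]];
  ces_density : exists2 c : R, 0 < c &
    forall B : set 'cV[R[i]]_p, measurable B ->
      P (x @^-1` B) = (\int[lebesgueCn R p]_(z in B)
        (c * (complex.Re (\det Sigma))^-1 *
         g (complex.Re (((z - mu)^t* *m invmx Sigma *m (z - mu)) 0 0)))%:E)%E;
  ces_mean : expect_mx P x = mu;
  ces_var : var_cV P x = Sigma
}.

Definition finite_fourth_moments d (T : measurableType d) (P : probability T R)
    p (x : T -> 'cV[R[i]]_p) : Prop :=
  forall j, ('E_P[fun w => (normc (x w j 0) ^+ 4)%R] < +oo)%E.

Definition elliptical_kurtosis d (T : measurableType d) (P : probability T R)
    (r : T -> R) (p : nat) : R :=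
  fine 'E_P[fun w => r w ^+ 4] / (p%:R * (p%:R + 1)) - 1.

Definition mse d (T : measurableType d) (P : probability T R) p
    (S : T -> 'M[R[i]]_p) (Sigma : 'M[R[i]]_p) : \bar R :=
  'E_P[fun w => frobenius (S w - Sigma) ^+ 2].

Definition nmse d (T : measurableType d) (P : probability T R) p
    (S : T -> 'M[R[i]]_p) (Sigma : 'M[R[i]]_p) : \bar R :=
  (mse P S Sigma * ((frobenius Sigma ^+ 2)^-1)%:E)%E.

(* Traces of powers of a Hermitian matrix are real. *)
Definition trR p (A : 'M[R[i]]_p) : R := complex.Re (\tr A).

Definition sphericity p (Sigma : 'M[R[i]]_p) : R :=
  p%:R * trR (Sigma *m Sigma) / trR Sigma ^+ 2.

End distributions.

(* Main.v *)
(* Write x_i = mu + z_i.  The vector v = r u has a unitarily invariant law, so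
   its fourth moments can be computed with the unitaries 1 - (1 - i) q, for q an
   orthogonal projection: q = e_m e_m^T forces E[v_i v_j^* v_k^* v_l] = 0 unless
   the indices pair up, and the projection q onto e_i - e_j gives
   E|v_i|^4 = E|v_j|^4 = 2 E[|v_i|^2 |v_j|^2].  Summing over all indices fixes
   the remaining constant to E[r^4] / (p (p + 1)) = 1 + kappa, and z = A v with
   A A = Sigma yields the fourth moments of z.  On the other hand
   S = sum_ij c_ij z_i z_j^H with c_ij = (delta_ij - 1/n) / (n - 1).  By
   independence E[z_i z_j^* z_k^* z_l] only sees the pairings i = j, k = l and
   i = k, j = l, plus an excess proportional to kappa when all indices agree,
   and the weight sums (sum_i c_ii)^2 = 1, sum_ij c_ij^2 = 1/(n-1) and
   sum_i c_ii^2 = 1/n produce tau1 and tau2. *)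

From HB Require Import structures.
Require Import Defs.
From mathcomp Require Import all_boot all_order all_algebra.
From mathcomp Require Import sesquilinear spectral.
From mathcomp Require Import all_classical all_reals all_analysis.
From mathcomp Require Import measurable_realfun.
From mathcomp Require Import complex mxtens.
From mathcomp Require Import ring lra.

Set Implicit Arguments.
Unset Strict Implicit.
Unset Printing Implicit Defensive.

Import Order.TTheory GRing.Theory Num.Theory.
Import numFieldNormedType.Exports.
Import ComplexField.Normc.

Local Open Scope classical_set_scope.
Local Open Scope ring_scope.
Local Open Scope sesquilinear_scope.
Local Open Scope complex_scope.

(** * Complex random variables *)

(** Each [ces] hypothesis supplies its own [u] and square root [A], on a space that the sample need
    not share, so no joint representation of the sample is available. Only integrals of functions of
    a single observation are therefore moved between [P] and [Q]; what comes back involves [Sigma]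
    and [kappa] alone, and the observations are combined afterwards, on [P], by independence. Since
    [expectC] returns junk off the integrable functions, every linear step needs integrability. The
    class [L4] takes care of it: it is closed under linear combinations, and a product of four
    members is integrable. The moment assumption on the sample is turned into E[r^4] < oo, a
    property of the modular variate alone, which then serves the spherical sample as well. The
    unitaries multiply by i because a coordinate that occurs s times unconjugated and t times
    conjugated, s, t <= 2, picks up i^(s-t), which is 1 only for s = t; a sign change would not
    detect v_i^2. The same circularity makes E[z z^T] vanish, which is why the third pairing i = l,
    j = k leaves no term. *)

Section measurable_complex_functions.
Context d (T : measurableType d) (R : realType).
Implicit Types f g : T -> R[i].

Lemma measurable_funC f :
  measurable_fun setT (fun w => complex.Re (f w)) ->
  measurable_fun setT (fun w => complex.Im (f w)) -> measurable_fun setT f.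
Proof.
move=> mr mi.
rewrite (_ : f = (fun ab : R * R => ab.1 +i* ab.2) \o
                 (fun w => (complex.Re (f w), complex.Im (f w)))).
  by apply: measurableT_comp; [exact: measurable_Complex|
    exact/measurable_fun_pairP].
by apply/funext => w /=; case: (f w).
Qed.

Lemma measurable_funRe f :
  measurable_fun setT f -> measurable_fun setT (fun w => complex.Re (f w)).
Proof. by move=> mf; exact: (measurableT_comp measurable_Re mf). Qed.

Lemma measurable_funIm f :
  measurable_fun setT f -> measurable_fun setT (fun w => complex.Im (f w)).
Proof. by move=> mf; exact: (measurableT_comp measurable_Im mf). Qed.

Lemma ReM (x y : R[i]) : complex.Re (x * y) =
  complex.Re x * complex.Re y - complex.Im x * complex.Im y.
Proof. by case: x; case: y. Qed.

Lemma ImM (x y : R[i]) : complex.Im (x * y) =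
  complex.Re x * complex.Im y + complex.Im x * complex.Re y.
Proof. by case: x; case: y. Qed.

Lemma ReD (x y : R[i]) : complex.Re (x + y) = complex.Re x + complex.Re y.
Proof. by case: x; case: y. Qed.

Lemma ImD (x y : R[i]) : complex.Im (x + y) = complex.Im x + complex.Im y.
Proof. by case: x; case: y. Qed.

Lemma Re_conj (x : R[i]) : complex.Re (Num.conj x) = complex.Re x.
Proof. by case: x. Qed.

Lemma Im_conj (x : R[i]) : complex.Im (Num.conj x) = - complex.Im x.
Proof. by case: x. Qed.

Lemma measurable_funCD f g : measurable_fun setT f -> measurable_fun setT g ->
  measurable_fun setT (fun w => f w + g w).
Proof.
move=> mf mg; apply: measurable_funC.
  under eq_fun do rewrite ReD.
  by apply: measurable_funD; exact: measurable_funRe.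
under eq_fun do rewrite ImD.
by apply: measurable_funD; exact: measurable_funIm.
Qed.

Lemma measurable_funCM f g : measurable_fun setT f -> measurable_fun setT g ->
  measurable_fun setT (fun w => f w * g w).
Proof.
move=> mf mg; apply: measurable_funC.
  under eq_fun do rewrite ReM.
  by apply: measurable_funB; apply: measurable_funM;
    (exact: measurable_funRe || exact: measurable_funIm).
under eq_fun do rewrite ImM.
by apply: measurable_funD; apply: measurable_funM;
  (exact: measurable_funRe || exact: measurable_funIm).
Qed.

Lemma measurable_fun_conj f : measurable_fun setT f ->
  measurable_fun setT (fun w => Num.conj (f w)).
Proof.
move=> mf; apply: measurable_funC.
  by under eq_fun do rewrite Re_conj; exact: measurable_funRe.
under eq_fun do rewrite Im_conj.
by apply: measurable_funN; exact: measurable_funIm.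
Qed.

Lemma measurable_funC_sum I (s : seq I) (F : I -> T -> R[i]) :
  (forall i, measurable_fun setT (F i)) ->
  measurable_fun setT (fun w => \sum_(i <- s) F i w).
Proof.
move=> mF; elim: s => [|i s IHs].
  by under eq_fun do rewrite big_nil; exact: measurable_cst.
by under eq_fun do rewrite big_cons; exact: measurable_funCD.
Qed.

Lemma measurable_funC_prod I (s : seq I) (F : I -> T -> R[i]) :
  (forall i, measurable_fun setT (F i)) ->
  measurable_fun setT (fun w => \prod_(i <- s) F i w).
Proof.
move=> mF; elim: s => [|i s IHs].
  by under eq_fun do rewrite big_nil; exact: measurable_cst.
by under eq_fun do rewrite big_cons; exact: measurable_funCM.
Qed.

Lemma measurable_fun_real_complex (f : T -> R) : measurable_fun setT f ->
  measurable_fun setT (fun w => (f w)%:C).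
Proof. by move=> mf; apply: measurable_funC => //=; exact: measurable_cst. Qed.

Lemma normcE (z : R[i]) :
  normc z = Num.sqrt (complex.Re z ^+ 2 + complex.Im z ^+ 2).
Proof. by case: z. Qed.

Lemma measurable_normc f : measurable_fun setT f ->
  measurable_fun setT (fun w => normc (f w)).
Proof.
move=> mf.
under eq_fun do rewrite normcE.
have msqrt : measurable_fun setT (@Num.sqrt R).
  exact: continuous_measurable_fun (@sqrt_continuous R).
apply: (measurableT_comp msqrt).
by apply: measurable_funD; apply: measurable_funX;
  (exact: measurable_funRe || exact: measurable_funIm).
Qed.

End measurable_complex_functions.

Section complex_norm.
Context (R : realType).
Implicit Types z : R[i].

Lemma normc_ge0 z : 0 <= normc z.
Proof. by case: z => a b; exact: sqrtr_ge0. Qed.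

Lemma mulC_conj_normc z : (normc z ^+ 2)%:C = z * Num.conj z.
Proof.
case: z => a b /=; rewrite sqr_sqrtr ?addr_ge0 ?sqr_ge0//.
by apply/eqP; rewrite eq_complex/=; apply/andP; split; apply/eqP; ring.
Qed.

Lemma conjC_real (a : R) : Num.conj a%:C = a%:C.
Proof. exact: conjc_real. Qed.

Lemma normc_conj z : normc (Num.conj z) = normc z.
Proof. by case: z => a b /=; rewrite sqrrN. Qed.

Lemma normc_real (a : R) : 0 <= a -> normc a%:C = a.
Proof. by move=> a0; rewrite /= expr0n addr0 sqrtr_sqr ger0_norm. Qed.

Lemma Re_le_normc z : `|complex.Re z| <= normc z.
Proof.
by case: z => a b /=; rewrite -sqrtr_sqr ler_wsqrtr// lerDl sqr_ge0.
Qed.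

Lemma Im_le_normc z : `|complex.Im z| <= normc z.
Proof.
by case: z => a b /=; rewrite -sqrtr_sqr ler_wsqrtr// lerDr sqr_ge0.
Qed.

Lemma normc_prod I (s : seq I) (F : I -> R[i]) :
  normc (\prod_(i <- s) F i) = \prod_(i <- s) normc (F i).
Proof. exact: (big_morph (@normc R) (@normcM R) (@normc1 R)). Qed.

End complex_norm.

Section complex_expectation.
Context d (T : measurableType d) (R : realType) (P : probability T R).
Implicit Types f g : T -> R[i].

(** Exactly the condition under which neither component of [expectC] is a junk value. *)
Definition integrableC f : Prop :=
  P.-integrable setT (EFin \o (fun w => complex.Re (f w))) /\
  P.-integrable setT (EFin \o (fun w => complex.Im (f w))).

Lemma expectCE f : expectC P f =
  (\int[P]_w complex.Re (f w)) +i* (\int[P]_w complex.Im (f w)).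
Proof. by rewrite /expectC !unlock. Qed.

Lemma integrableC_measurable f : integrableC f -> measurable_fun setT f.
Proof.
by case=> /integrableP[/measurable_EFinP ? _]
  /integrableP[/measurable_EFinP ? _]; exact: measurable_funC.
Qed.

Lemma dominated_integrableC f (h : T -> R) : measurable_fun setT f ->
  P.-integrable setT (EFin \o h) -> (forall w, normc (f w) <= h w) ->
  integrableC f.
Proof.
move=> mf ih fh; split.
- apply: le_integrable ih => //.
    by apply/measurable_EFinP; exact: measurable_funRe.
  move=> w _ /=; rewrite lee_fin (le_trans (Re_le_normc _))//.
  by rewrite (le_trans (fh w))// ler_norm.
- apply: le_integrable ih => //.
    by apply/measurable_EFinP; exact: measurable_funIm.
  move=> w _ /=; rewrite lee_fin (le_trans (Im_le_normc _))//.
  by rewrite (le_trans (fh w))// ler_norm.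
Qed.

Lemma integrable_normc f :
  integrableC f -> P.-integrable setT (EFin \o (fun w => normc (f w))).
Proof.
move=> intf; have mf := integrableC_measurable intf.
case: intf => /integrable_abse ir /integrable_abse ii.
have := integrableD measurableT ir ii.
apply: le_integrable => //.
  by apply/measurable_EFinP; exact: measurable_normc.
move=> w _ /=; rewrite lee_fin ger0_norm ?normc_ge0// ger0_norm ?addr_ge0//.
case: (f w) => a b /=.
(* sqrt(a^2 + b^2) <= |a| + |b|: after squaring, the difference is the cross term 2|a||b|. *)
rewrite -[leRHS]ger0_norm ?addr_ge0// -sqrtr_sqr ler_wsqrtr//.
rewrite sqrrD !real_normK ?num_real// -addrA lerD2l lerDr.
by rewrite mulrn_wge0// mulr_ge0.
Qed.

Lemma integrableC_cst c : integrableC (fun=> c).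
Proof.
by split; apply: finite_measure_integrable_cst.
Qed.

Lemma expectC_cst c : expectC P (fun=> c) = c.
Proof.
rewrite expectCE !Rintegral_cst//= probability_setT /= !mulr1.
by case: c.
Qed.

Lemma integrableCD f g : integrableC f -> integrableC g ->
  integrableC (fun w => f w + g w).
Proof.
move=> [fr fi] [gr gi]; split.
  have := integrableD measurableT fr gr.
  by apply: eq_integrable => // w _ /=; rewrite ReD.
have := integrableD measurableT fi gi.
by apply: eq_integrable => // w _ /=; rewrite ImD.
Qed.

Lemma expectCD f g : integrableC f -> integrableC g ->
  expectC P (fun w => f w + g w) = expectC P f + expectC P g.
Proof.
move=> [fr fi] [gr gi]; rewrite !expectCE.
under eq_Rintegral do rewrite ReD.
under [X in _ +i* X]eq_Rintegral do rewrite ImD.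
by rewrite !RintegralD.
Qed.

Lemma integrableCZ c f : integrableC f -> integrableC (fun w => c * f w).
Proof.
move=> [fr fi]; split.
  have := integrableB measurableT
    (integrableZl measurableT (complex.Re c) fr)
    (integrableZl measurableT (complex.Im c) fi).
  by apply: eq_integrable => // w _ /=; rewrite ReM.
have := integrableD measurableT
  (integrableZl measurableT (complex.Re c) fi)
  (integrableZl measurableT (complex.Im c) fr).
by apply: eq_integrable => // w _ /=; rewrite ImM.
Qed.

Lemma expectCZ c f : integrableC f ->
  expectC P (fun w => c * f w) = c * expectC P f.
Proof.
move=> [fr fi]; rewrite !expectCE.
have irr := integrableZl measurableT (complex.Re c) fr.
have iri := integrableZl measurableT (complex.Re c) fi.
have iir := integrableZl measurableT (complex.Im c) fr.
have iii := integrableZl measurableT (complex.Im c) fi.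
under eq_Rintegral do rewrite ReM.
under [X in _ +i* X]eq_Rintegral do rewrite ImM.
rewrite RintegralB ?RintegralD ?RintegralZl//.
by case: c {irr iri iir iii}.
Qed.

Lemma integrableC_conj f :
  integrableC f -> integrableC (fun w => Num.conj (f w)).
Proof.
move=> [fr fi]; split.
  by apply: eq_integrable fr => // w _ /=; rewrite Re_conj.
by have := integrableN fi;
  apply: eq_integrable => // w _ /=; rewrite Im_conj.
Qed.

Lemma expectC_conj f : integrableC f ->
  expectC P (fun w => Num.conj (f w)) = Num.conj (expectC P f).
Proof.
move=> [fr fi]; rewrite !expectCE.
under eq_Rintegral do rewrite Re_conj.
under [X in _ +i* X]eq_Rintegral do rewrite Im_conj -mulN1r.
by rewrite RintegralZl// mulN1r.
Qed.

Lemma integrableC_sum I (s : seq I) (F : I -> T -> R[i]) :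
  (forall i, integrableC (F i)) ->
  integrableC (fun w => \sum_(i <- s) F i w).
Proof.
move=> iF; elim: s => [|i s IHs].
  by under eq_fun do rewrite big_nil; exact: integrableC_cst.
by under eq_fun do rewrite big_cons; exact: integrableCD.
Qed.

Lemma expectC_sum I (s : seq I) (F : I -> T -> R[i]) :
  (forall i, integrableC (F i)) ->
  expectC P (fun w => \sum_(i <- s) F i w) = \sum_(i <- s) expectC P (F i).
Proof.
move=> iF; elim: s => [|i s IHs].
  by under eq_fun do rewrite big_nil; rewrite expectC_cst big_nil.
under eq_fun do rewrite big_cons.
by rewrite big_cons -IHs expectCD//; exact: integrableC_sum.
Qed.

Lemma integrableCB f g : integrableC f -> integrableC g ->
  integrableC (fun w => f w - g w).
Proof.
move=> intf intg; under eq_fun do rewrite -mulN1r.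
by apply: integrableCD => //; exact: integrableCZ.
Qed.

Lemma expectCB f g : integrableC f -> integrableC g ->
  expectC P (fun w => f w - g w) = expectC P f - expectC P g.
Proof.
move=> intf intg; under eq_fun do rewrite -mulN1r.
by rewrite expectCD ?expectCZ ?mulN1r//; exact: integrableCZ.
Qed.

Lemma covCE f g : integrableC f -> integrableC g ->
  integrableC (fun w => f w * Num.conj (g w)) ->
  covC P f g = expectC P (fun w => f w * Num.conj (g w)) -
               expectC P f * Num.conj (expectC P g).
Proof.
move=> intf intg intfg; rewrite /covC.
set a := expectC P f; set b := expectC P g.
have -> : (fun w => (f w - a) * Num.conj (g w - b)) =
    (fun w => (f w * Num.conj (g w) - Num.conj b * f w) -
              (a * Num.conj (g w) - a * Num.conj b)).
  by apply/funext => w; rewrite rmorphB/=; ring.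
have icg := integrableC_conj intg.
have i1 := integrableCZ (Num.conj b) intf.
have i2 := integrableCZ a icg.
have i3 := integrableC_cst (a * Num.conj b).
have i4 := integrableCB intfg i1.
have i5 := integrableCB i2 i3.
rewrite !expectCB// expectC_cst !expectCZ// expectC_conj//.
by rewrite -/a -/b; ring.
Qed.

Lemma expectC_real (f : T -> R) :
  P.-integrable setT (EFin \o f) ->
  ('E_P[f])%E = (complex.Re (expectC P (fun w => (f w)%:C)))%:E.
Proof.
by move=> fi; rewrite unlock expectCE /= /Rintegral fineK// integrable_fin_num.
Qed.

(** Needed because ||u|| = 1 is only known almost everywhere. *)
Lemma expectC_ae f g : measurable_fun setT f -> measurable_fun setT g ->
  {ae P, forall w, f w = g w} -> expectC P f = expectC P g.
Proof.
move=> mf mg fg; rewrite !expectCE /Rintegral.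
congr (fine _ +i* fine _); apply: ae_eq_integral => //;
  do ?[by apply/measurable_EFinP; exact: measurable_funRe|
       by apply/measurable_EFinP; exact: measurable_funIm].
- by apply: filterS fg => w /= ->.
- by apply: filterS fg => w /= ->.
Qed.

End complex_expectation.

(** * Independence and expectations *)

Section independence.
Context d (T : measurableType d) (R : realType) (P : probability T R).
Context d' (U : measurableType d').

Import HBNNSimple.

(** One-factor step of the product rule: [h] stands for the product of the other factors and [c] for
    its expectation. Factorisation on the events X in B extends to simple functions by linearity,
    then to nonnegative measurable [f] by monotone convergence. *)
Lemma ge0_integral_indep (h : T -> R) (c : R) (X : T -> U) (f : U -> R) :
  measurable_fun setT h -> measurable_fun setT X -> measurable_fun setT f ->
  (forall w, 0 <= h w) -> (forall u, 0 <= f u) ->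
  (forall B, measurable B ->
    (\int[P]_w (h w * \1_B (X w))%:E = c%:E * P (X @^-1` B))%E) ->
  (\int[P]_w (h w * f (X w))%:E = c%:E * \int[P]_w (f (X w))%:E)%E.
Proof.
move=> mh mX mf h0 f0 hX.
have c0 : 0 <= c.
  have := hX setT measurableT.
  rewrite preimage_setT probability_setT mule1 => hc.
  by rewrite -lee_fin -hc; apply: integral_ge0 => w _; rewrite lee_fin mulr_ge0.
have mfE : measurable_fun setT (EFin \o f) by exact/measurable_EFinP.
pose g := nnsfun_approx measurableT mfE.
have mg k : measurable_fun setT (fun w => g k (X w)).
  exact: measurableT_comp.
have gf w : (EFin \o g ^~ (X w)) @ \oo --> (f (X w))%:E.
  by apply: cvg_nnsfun_approx => // u _; rewrite /= lee_fin.
have ndg w m k : (m <= k)%N -> g m (X w) <= g k (X w).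
  by move=> mk; exact/lefP/nd_nnsfun_approx.
have gE k : (\int[P]_w (h w * g k (X w))%:E =
             c%:E * \int[P]_w (g k (X w))%:E)%E.
  pose F y w := (y * \1_(g k @^-1` [set y]) (X w) : R).
  have mI y : measurable_fun setT
      (fun w => \1_(g k @^-1` [set y]) (X w) : R).
    by apply: measurableT_comp.
  have mF y : measurable_fun setT (F y) by exact: measurable_funM.
  have F0 y w : 0 <= F y w.
    rewrite /F indicE; case: (boolP (X w \in _)) => [|_]; last by rewrite mulr0.
    by rewrite inE /= => <-; rewrite mulr_ge0.
  have hF y : (\int[P]_w (h w * F y w)%:E = c%:E * \int[P]_w (F y w)%:E)%E.
    (* The fibre over a negative [y] is empty, since [g k] is nonnegative; the case is split off
       because pulling [y] out of the integral requires y >= 0. *)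
    have [y0|y0] := ltP y 0.
      have FE w : F y w = 0.
        rewrite /F indicE; case: (boolP (X w \in _)) => [|_].
          2: by rewrite mulr0.
        by rewrite inE /= => gy; move: y0; rewrite -gy ltNge fun_ge0.
      under eq_integral do rewrite FE mulr0.
      under [X in (_ = _ * X)%E]eq_integral do rewrite FE.
      by rewrite integral0 mule0.
    have mgy : measurable (g k @^-1` [set y]) by [].
    under eq_integral do rewrite /F mulrCA EFinM.
    rewrite ge0_integralZl_EFin//; last 2 first.
    - by move=> w _; rewrite lee_fin mulr_ge0.
    - by apply/measurable_EFinP; exact: measurable_funM.
    under [X in (_ = _ * X)%E]eq_integral do rewrite /F EFinM.
    rewrite ge0_integralZl_EFin//; last exact/measurable_EFinP.
    rewrite (hX _ mgy) muleCA; congr (_ * (_ * _))%E.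
    rewrite (_ : (fun w => _) = EFin \o \1_(X @^-1` (g k @^-1` [set y]))).
      rewrite integral_indic ?setIT//.
      by rewrite -[X in measurable X]setTI; exact: mX.
    by apply/funext => w /=; rewrite !indicE.
  have gsum w : g k (X w) = \sum_(y \in range (g k)) F y w.
    exact: fimfunE.
  have fing : finite_set (range (g k)) by exact: fimfunP.
  under eq_integral do rewrite gsum mulr_fsumr -fsumEFin//.
  rewrite ge0_integral_fsum//; last 2 first.
  - by move=> y; apply/measurable_EFinP; exact: measurable_funM.
  - by move=> y w _; rewrite lee_fin mulr_ge0.
  under [X in (_ = _ * X)%E]eq_integral do rewrite gsum -fsumEFin//.
  rewrite ge0_integral_fsum//; last 2 first.
  - by move=> y; exact/measurable_EFinP.
  - by move=> y w _; rewrite lee_fin.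
  rewrite ge0_mule_fsumr; last first.
    by move=> y; apply: integral_ge0 => w _; rewrite lee_fin.
  by apply: eq_fsbigr => y _; exact: hF.
have lim_hg : (fun k => \int[P]_w (h w * g k (X w))%:E)%E @ \oo -->
    (\int[P]_w (h w * f (X w))%:E)%E.
  rewrite (_ : (\int[P]_w (h w * f (X w))%:E)%E =
      (\int[P]_w limn (fun k => (h w * g k (X w))%:E))%E).
    apply: cvg_monotone_convergence => //.
    - by move=> k; apply/measurable_EFinP; exact: measurable_funM.
    - by move=> k w _; rewrite lee_fin mulr_ge0.
    - by move=> w _ m k mk; rewrite lee_fin ler_wpM2l ?ndg.
  apply: eq_integral => w _; apply/esym/cvg_lim => //.
  rewrite EFinM; under eq_fun do rewrite EFinM.
  by apply: cvgeZl => //; exact: gf.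
have lim_g : (fun k => \int[P]_w (g k (X w))%:E)%E @ \oo -->
    (\int[P]_w (f (X w))%:E)%E.
  rewrite (_ : (\int[P]_w (f (X w))%:E)%E =
      (\int[P]_w limn (fun k => (g k (X w))%:E))%E).
    apply: cvg_monotone_convergence => //.
    - by move=> k; exact/measurable_EFinP.
    - by move=> k w _; rewrite lee_fin.
    - by move=> w _ m k mk; rewrite lee_fin ndg.
  by apply: eq_integral => w _; apply/esym/cvg_lim => //; exact: gf.
rewrite (funext gE) in lim_hg.
by apply: cvg_unique lim_hg _ => //; exact: cvgeZl.
Qed.

Context (n : nat) (X : 'I_n -> {RV P >-> U}).
Hypothesis indX : mutually_independent X.

Lemma mutually_independent_ge0_integral (f : 'I_n -> U -> R) :
  (forall m, measurable_fun setT (f m)) -> (forall m u, 0 <= f m u) ->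
  (forall m, \int[P]_w (f m (X m w))%:E < +oo)%E ->
  (\int[P]_w (\prod_(m < n) f m (X m w))%:E =
   (\prod_(m < n) \int[P]_w f m (X m w))%:E)%E.
Proof.
move=> mf f0 foo.
(* Induction on the number of factors that are not indicator functions. *)
suff H k : forall f : 'I_n -> U -> R,
    (forall m, measurable_fun setT (f m)) -> (forall m u, 0 <= f m u) ->
    (forall m, \int[P]_w (f m (X m w))%:E < +oo)%E ->
    (forall m : 'I_n, (k <= m)%N -> exists2 B, measurable B & f m = \1_B) ->
    (\int[P]_w (\prod_(m < n) f m (X m w))%:E =
     (\prod_(m < n) \int[P]_w f m (X m w))%:E)%E.
  by apply: (H n) => // m; rewrite leqNgt ltn_ord.
elim: k {f mf f0 foo} => [f mf f0 foo fI|k IHk f mf f0 foo fI].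
  have /choice[B HB] : forall m, exists B, measurable B /\ f m = \1_B.
    by move=> m; have [B ? ?] := fI m isT; exists B.
  have mXB m : measurable (X m @^-1` B m).
    by rewrite -[X in measurable X]setTI; apply: measurable_funPT => //;
      have [] := HB m.
  have fE m : \int[P]_w f m (X m w) = fine (P (X m @^-1` B m)).
    rewrite /Rintegral (HB m).2; congr fine.
    rewrite (_ : (fun w => _) = EFin \o \1_(X m @^-1` B m)).
      by rewrite integral_indic ?setIT.
    by apply/funext => w /=; rewrite !indicE.
  (* With indicators only, the integrand is the indicator of the intersection, and the claim is the
     definition of mutual independence. *)
  transitivity (P (\bigcap_(i in [set: 'I_n]) (X i @^-1` B i))).
    rewrite -[X in _ = P X]setIT -integral_indic//; last first.
      exact: fin_bigcap_measurable.
    apply: eq_integral => w _; congr EFin.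
    under eq_bigr do rewrite (HB _).2.
    rewrite indicE; case: (boolP (w \in _)) => [|/negP]; rewrite inE => Bw.
      by rewrite big1// => m _; rewrite indicE mem_set//; exact: Bw.
    have [m Bm] : exists m, ~ B m (X m w).
      by apply/existsNP => BXw; apply: Bw => m _; exact: BXw.
    by rewrite (bigD1 m)//= indicE memNset// mul0r.
  rewrite indX; last by move=> m; have [] := HB m.
  under [in RHS]eq_bigr do rewrite fE.
  by rewrite -prodEFin; apply: eq_bigr => m _; rewrite fineK// fin_num_measure.
have [nk|kn] := leqP n k.
  by apply: IHk => // m km; have := ltn_ord m; rewrite ltnNge (leq_trans nk).
pose i := Ordinal kn.
rewrite [X in _ = X%:E](bigD1 i)//= mulrC EFinM.
under eq_integral => w _ do rewrite (bigD1 i)//= mulrC.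
(* The other factors act as [h]. Their factorisation on events is the induction hypothesis for [f'],
   in which the factor at [i] is replaced by an indicator. *)
rewrite (ge0_integral_indep (h := fun w => \prod_(m < n | m != i) f m (X m w))
   (c := \prod_(m < n | m != i) \int[P]_w f m (X m w)) (X := X i) (f := f i))//.
- rewrite /Rintegral fineK// ge0_fin_numE// integral_ge0// => w _.
  by rewrite lee_fin.
- under eq_fun do rewrite -big_filter.
  by apply: measurable_prod => m _; exact: measurableT_comp.
- by move=> w; apply: prodr_ge0.
move=> B mB.
have [f' [f'i f'f]] : exists f' : 'I_n -> U -> R,
    f' i = \1_B /\ forall m, m != i -> f' m = f m.
  exists (fun m => if m == i then \1_B else f m).
  by rewrite eqxx; split=> // m /negbTE ->.
have intB : (\int[P]_w (\1_B (X i w))%:E = P (X i @^-1` B))%E.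
  rewrite (_ : (fun w => _) = EFin \o \1_(X i @^-1` B)).
    by rewrite integral_indic ?setIT// -[X in measurable X]setTI;
      apply: measurable_funPT.
  by apply/funext => w /=; rewrite !indicE.
transitivity (\int[P]_w (\prod_(m < n) f' m (X m w))%:E)%E.
  apply: eq_integral => w _; rewrite [in RHS](bigD1 i)//= f'i mulrC.
  congr (_ * _)%:E.
  by apply: eq_bigr => m mi; rewrite f'f.
rewrite IHk.
- rewrite [in LHS](bigD1 i)//= f'i /Rintegral intB mulrC EFinM.
  rewrite fineK ?fin_num_measure//.
    by congr (_%:E * _)%E; apply: eq_bigr => m mi; rewrite f'f.
  by rewrite -[X in measurable X]setTI; apply: measurable_funPT.
- by move=> m; have [->|mi] := eqVneq m i; rewrite ?f'i ?f'f.
- by move=> m u; have [->|mi] := eqVneq m i; rewrite ?f'i ?f'f.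
- move=> m; have [->|mi] := eqVneq m i; last by rewrite f'f.
  by rewrite f'i intB (le_lt_trans (probability_le1 _ _)) ?ltry//
       -[X in measurable X]setTI; apply: measurable_funPT.
- move=> m km; have [->|mi] := eqVneq m i; first by rewrite f'i; exists B.
  rewrite f'f//; apply: fI; rewrite ltn_neqAle km andbT.
  by apply: contra_neq mi => kE; apply/val_inj; rewrite /= kE.
Qed.

(** The product rule for nonnegative functions, applied to the moduli, shows that the product of the
    moduli has a finite integral, and it dominates. *)
Lemma mutually_independent_integrableC (f : 'I_n -> U -> R[i]) :
  (forall m, measurable_fun setT (f m)) ->
  (forall m, integrableC P (fun w => f m (X m w))) ->
  integrableC P (fun w => \prod_(m < n) f m (X m w)).
Proof.
move=> mf intf.
apply: (@dominated_integrableC _ _ _ _ _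
    (fun w => \prod_(m < n) normc (f m (X m w)))).
- by apply: measurable_funC_prod => m; exact: measurableT_comp.
- apply/integrableP; split.
    apply/measurable_EFinP; apply: measurable_prod => m _.
    by apply: measurable_normc; exact: measurableT_comp.
  have absE w : `|\prod_(m < n) normc (f m (X m w))| =
      \prod_(m < n) normc (f m (X m w)).
    by rewrite ger0_norm//; apply: prodr_ge0 => m _; exact: normc_ge0.
  under eq_integral do rewrite /= absE.
  rewrite (@mutually_independent_ge0_integral (fun m u => normc (f m u)))
    ?ltry//.
  + by move=> m; exact: measurable_normc.
  + by move=> m u; exact: normc_ge0.
  + move=> m; have /integrableP[_] := integrable_normc (intf m).
    have absEm w : `|normc (f m (X m w))| = normc (f m (X m w)).
      by rewrite ger0_norm// normc_ge0.
    by under eq_integral do rewrite /= absEm.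
- by move=> w; rewrite normc_prod.
Qed.

Lemma mutually_independent_expectC (f : 'I_n -> U -> R[i]) :
  (forall m, measurable_fun setT (f m)) ->
  (forall m, integrableC P (fun w => f m (X m w))) ->
  expectC P (fun w => \prod_(m < n) f m (X m w)) =
  \prod_(m < n) expectC P (fun w => f m (X m w)).
Proof.
move=> mf intf.
(* Induction on the number of factors that are not real and nonnegative. *)
suff H k : forall f : 'I_n -> U -> R[i],
    (forall m, measurable_fun setT (f m)) ->
    (forall m, integrableC P (fun w => f m (X m w))) ->
    (forall m : 'I_n, (k <= m)%N -> exists g : U -> R,
      [/\ measurable_fun setT g, forall u, 0 <= g u &
          f m = (fun u => (g u)%:C)]) ->
    expectC P (fun w => \prod_(m < n) f m (X m w)) =
    \prod_(m < n) expectC P (fun w => f m (X m w)).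
  by apply: (H n) => // m; rewrite leqNgt ltn_ord.
elim: k {f mf intf} => [f mf intf fR|k IHk f mf intf fR].
  have /choice[g Hg] := fun m => fR m isT.
  have mg m : measurable_fun setT (g m) by have [] := Hg m.
  have g0 m u : 0 <= g m u by have [] := Hg m.
  have fE m u : f m u = (g m u)%:C by have [_ _ ->] := Hg m.
  have intg m : P.-integrable setT (EFin \o (fun w => g m (X m w))).
    by have [+ _] := intf m; apply: eq_integrable => // w _ /=; rewrite fE.
  have prodE (r : 'I_n -> R) :
      \prod_(m < n) (r m)%:C = (\prod_(m < n) r m)%:C.
    by rewrite rmorph_prod.
  have EE m : expectC P (fun w => f m (X m w)) = (\int[P]_w g m (X m w))%:C.
    rewrite expectCE; under eq_Rintegral do rewrite fE.
    under [X in _ +i* X]eq_Rintegral do rewrite fE.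
    by rewrite /= Rintegral_cst//= mul0r.
  under eq_bigr do rewrite EE; rewrite prodE.
  rewrite (_ : (fun w => _) =
      fun w => (\prod_(m < n) g m (X m w))%:C); last first.
    by apply/funext => w; rewrite -prodE; apply: eq_bigr => m _; rewrite fE.
  rewrite expectCE /= Rintegral_cst//= mul0r; congr (_ +i* _).
  rewrite {1}/Rintegral mutually_independent_ge0_integral// => m.
  have /integrableP[_] := intg m.
  by under eq_integral do rewrite /= ger0_norm//.
have [nk|kn] := leqP n k.
  by apply: IHk => // m km; have := ltn_ord m; rewrite ltnNge (leq_trans nk).
pose i := Ordinal kn.
(* Positive and negative parts of the real and imaginary parts; with the units 1, -1, i, -i they
   recombine to [f i]. Both sides of the claim are linear in [f i], and each part is real and
   nonnegative, so the induction hypothesis covers it. *)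
pose part (t : 'I_4) (u : U) : R := Num.max 0
  (tnth [tuple complex.Re (f i u); - complex.Re (f i u);
               complex.Im (f i u); - complex.Im (f i u)] t).
pose unit4 (t : 'I_4) : R[i] := tnth [tuple 1; -1; 'i%C; - 'i%C] t.
have fiE u : f i u = \sum_(t < 4) unit4 t * (part t u)%:C.
  rewrite !big_ord_recl big_ord0 /unit4 /part !(tnth_nth 0)/=.
  have maxB (a : R) : Num.max 0 a - Num.max 0 (- a) = a.
    by rewrite /Num.max oppr_gt0; case: ltgtP => [|a0|<-];
      rewrite ?subr0 ?sub0r ?opprK.
  rewrite [LHS]complexE -{1}(maxB (complex.Re (f i u))).
  rewrite -{1}(maxB (complex.Im (f i u))) !rmorphB/=.
  ring.
have mpart t : measurable_fun setT (part t).
  have mre := measurable_funRe (mf i); have mim := measurable_funIm (mf i).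
  rewrite /part; apply: measurable_maxr => //.
  case: t => -[|[|[|[|//]]]] ?; under eq_fun do rewrite (tnth_nth 0)/=;
    by [|exact: measurable_funN].
have part0 t u : 0 <= part t u by rewrite le_max lexx.
have part_le t u : part t u <= normc (f i u).
  have /ler_normlP[? ?] := Re_le_normc (f i u).
  have /ler_normlP[? ?] := Im_le_normc (f i u).
  rewrite /part ge_max normc_ge0 (tnth_nth 0).
  by case: t => -[|[|[|[|//]]]] ?.
have intpart t : integrableC P (fun w => (part t (X i w))%:C).
  apply: (dominated_integrableC _ (integrable_normc (intf i))).
    apply: measurable_fun_real_complex.
    exact: measurableT_comp.
  by move=> w; rewrite normc_real.
have [f' [f'i f'f]] : exists f' : 'I_4 -> 'I_n -> U -> R[i],
    (forall t, f' t i = fun u => (part t u)%:C) /\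
    (forall t m, m != i -> f' t m = f m).
  exists (fun t m => if m == i then fun u => (part t u)%:C else f m).
  by rewrite eqxx; split=> // t m /negbTE ->.
have mf' t m : measurable_fun setT (f' t m).
  have [->|mi] := eqVneq m i; last by rewrite f'f.
  by rewrite f'i; exact: measurable_fun_real_complex.
have intf' t m : integrableC P (fun w => f' t m (X m w)).
  by have [->|mi] := eqVneq m i; rewrite ?f'i ?f'f.
have IHt t : expectC P (fun w => \prod_(m < n) f' t m (X m w)) =
    \prod_(m < n) expectC P (fun w => f' t m (X m w)).
  apply: IHk => // m km; have [->|mi] := eqVneq m i.
    by rewrite f'i; exists (part t).
  rewrite f'f//; apply: fR; rewrite ltn_neqAle km andbT.
  by apply: contra_neq mi => kE; apply/val_inj; rewrite /= kE.
rewrite (_ : (fun w => _) =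
    fun w => \sum_(t < 4) unit4 t * \prod_(m < n) f' t m (X m w)).
  rewrite expectC_sum => [|t]; last first.
    by apply: integrableCZ; exact: mutually_independent_integrableC.
  rewrite [in RHS](bigD1 i)//= (_ : expectC P (fun w => f i (X i w)) =
      \sum_(t < 4) unit4 t * expectC P (fun w => (part t (X i w))%:C)).
    rewrite mulr_suml; apply: eq_bigr => t _.
    rewrite expectCZ; last exact: mutually_independent_integrableC.
    rewrite IHt (bigD1 i)//= f'i mulrA; congr (_ * _).
    by apply: eq_bigr => m mi; rewrite f'f.
  under eq_fun do rewrite fiE.
  rewrite expectC_sum => [|t]; last exact: integrableCZ.
  by apply: eq_bigr => t _; rewrite expectCZ.
apply/funext => w; rewrite (bigD1 i)//= fiE mulr_suml; apply: eq_bigr => t _.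
rewrite [in RHS](bigD1 i)//= f'i mulrA; congr (_ * _).
by apply: eq_bigr => m mi; rewrite f'f.
Qed.
End independence.

(** * Laws and fourth moments *)

Section same_law.
Context d (T : measurableType d) d' (T' : measurableType d') (R : realType).
Context (P : probability T R) (Q : probability T' R).
Context d1 (U : measurableType d1).

(** Two spaces are allowed for the stochastic representation of an observation; with P = Q the same
    notion expresses unitary invariance. *)
Definition same_law (x : T -> U) (y : T' -> U) : Prop :=
  forall B, measurable B -> P (x @^-1` B) = Q (y @^-1` B).

Context (x : T -> U) (y : T' -> U).
Hypotheses (mx : measurable_fun setT x) (my : measurable_fun setT y).
Hypothesis xy : same_law x y.

(** Both sides are integrals of [f] against the pushforward laws, which agree on measurable sets. *)
Lemma same_law_ge0_integral (f : U -> \bar R) :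
  measurable_fun setT f -> (forall u, 0 <= f u)%E ->
  (\int[P]_w f (x w) = \int[Q]_w f (y w))%E.
Proof.
move=> mf f0.
pose X : {mfun T >-> U} := HB.pack x (isMeasurableFun.Build _ _ _ _ _ mx).
pose Y : {mfun T' >-> U} := HB.pack y (isMeasurableFun.Build _ _ _ _ _ my).
transitivity (\int[distribution P X]_u f u)%E.
  by rewrite ge0_integral_distribution.
transitivity (\int[distribution Q Y]_u f u)%E.
  by apply: eq_measure_integral => B mB _; exact: xy.
by rewrite ge0_integral_distribution.
Qed.

Lemma same_law_Rintegral (f : U -> R) : measurable_fun setT f ->
  \int[P]_w f (x w) = \int[Q]_w f (y w).
Proof.
move=> mf; have mE : measurable_fun setT (EFin \o f) by exact/measurable_EFinP.
rewrite /Rintegral; congr fine; rewrite integralE [RHS]integralE.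
congr (_ - _)%E.
  rewrite (funepos_comp (EFin \o f) x) (funepos_comp (EFin \o f) y).
  exact: same_law_ge0_integral (measurable_funepos mE) (@funepos_ge0 _ _ _).
rewrite (funeneg_comp (EFin \o f) x) (funeneg_comp (EFin \o f) y).
exact: same_law_ge0_integral (measurable_funeneg mE) (@funeneg_ge0 _ _ _).
Qed.

Lemma same_law_expectC (f : U -> R[i]) : measurable_fun setT f ->
  expectC P (fun w => f (x w)) = expectC Q (fun w => f (y w)).
Proof.
move=> mf; rewrite !expectCE; congr (_ +i* _).
  exact: (same_law_Rintegral (measurable_funRe mf)).
exact: (same_law_Rintegral (measurable_funIm mf)).
Qed.

End same_law.

Section fourth_moments.
Context d (T : measurableType d) (R : realType) (P : probability T R).
Implicit Types f g : T -> R[i].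

Definition L4 f : Prop := measurable_fun setT f /\
  (\int[P]_w (normc (f w) ^+ 4)%:E < +oo)%E.

Let m4 f : measurable_fun setT f ->
  measurable_fun setT (fun w => normc (f w) ^+ 4).
Proof. by move=> mf; apply: measurable_funX; exact: measurable_normc. Qed.

Lemma L4_integrable f :
  L4 f -> P.-integrable setT (EFin \o (fun w => normc (f w) ^+ 4)).
Proof.
move=> [mf foo]; apply/integrableP; split; first exact/measurable_EFinP/m4.
have absE w : `|normc (f w) ^+ 4| = normc (f w) ^+ 4.
  by rewrite ger0_norm// exprn_ge0// normc_ge0.
by under eq_integral do rewrite /= absE.
Qed.

Lemma L4_le f (h : T -> R) : measurable_fun setT f ->
  P.-integrable setT (EFin \o h) -> (forall w, normc (f w) ^+ 4 <= h w) ->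
  L4 f.
Proof.
move=> mf /integrableP[mh hoo] fh; split=> //; apply: le_lt_trans hoo.
apply: ge0_le_integral => //.
- by move=> w _; rewrite lee_fin exprn_ge0// normc_ge0.
- exact/measurable_EFinP/m4.
- exact: measurableT_comp.
- by move=> w _ /=; rewrite lee_fin (le_trans (fh w))// ler_norm.
Qed.

Lemma L4_cst c : L4 (fun=> c).
Proof.
apply: (@L4_le _ (fun=> normc c ^+ 4)) => //.
exact: finite_measure_integrable_cst.
Qed.

Lemma L4Z c f : L4 f -> L4 (fun w => c * f w).
Proof.
move=> [mf foo]; apply: (@L4_le _ (fun w => normc c ^+ 4 * normc (f w) ^+ 4)).
- exact: measurable_funCM.
- exact: (integrableZl measurableT _ (L4_integrable _)).
- by move=> w; rewrite normcM exprMn.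
Qed.

Lemma L4_conj f : L4 f -> L4 (fun w => Num.conj (f w)).
Proof.
move=> [mf foo]; split; first exact: measurable_fun_conj.
by under eq_integral do rewrite normc_conj.
Qed.

Lemma L4D f g : L4 f -> L4 g -> L4 (fun w => f w + g w).
Proof.
move=> Lf Lg; have [[mf _] [mg _]] := (Lf, Lg).
(* The constant 8 comes from using (a + b)^2 <= 2 (a^2 + b^2) twice: (a + b)^4 <= 4 (a^2 + b^2)^2 <=
   8 (a^4 + b^4). *)
have ifg := integrableZl measurableT 8
  (integrableD measurableT (L4_integrable Lf) (L4_integrable Lg)).
apply: (@L4_le _ (fun w => 8 * (normc (f w) ^+ 4 + normc (g w) ^+ 4))) => //.
  exact: measurable_funCD.
move=> w; have : normc (f w + g w) <= normc (f w) + normc (g w).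
  exact: le_normcD.
move: (normc_ge0 (f w)) (normc_ge0 (g w)) (normc_ge0 (f w + g w)).
move: (normc (f w)) (normc (g w)) (normc (f w + g w)) => a b s a0 b0 s0 sab.
apply: (@le_trans _ _ ((a + b) ^+ 4)).
  by rewrite lerXn2r ?nnegrE ?addr_ge0.
have ab : (a + b) ^+ 2 <= 2 * (a ^+ 2 + b ^+ 2).
  by have := sqr_ge0 (a - b); lra.
have : ((a + b) ^+ 2) ^+ 2 <= (2 * (a ^+ 2 + b ^+ 2)) ^+ 2.
  by rewrite lerXn2r ?nnegrE ?sqr_ge0 ?mulr_ge0 ?addr_ge0 ?sqr_ge0.
by have := sqr_ge0 (a ^+ 2 - b ^+ 2); lra.
Qed.

Lemma L4_sum I (s : seq I) (F : I -> T -> R[i]) :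
  (forall i, L4 (F i)) -> L4 (fun w => \sum_(i <- s) F i w).
Proof.
move=> LF; elim: s => [|i s IHs].
  by under eq_fun do rewrite big_nil; exact: L4_cst.
by under eq_fun do rewrite big_cons; exact: L4D.
Qed.

Lemma L4B f g : L4 f -> L4 g -> L4 (fun w => f w - g w).
Proof.
by move=> Lf Lg; under eq_fun do rewrite -mulN1r; apply: L4D => //; exact: L4Z.
Qed.

Lemma L4_integrableC4 f1 f2 f3 f4 : L4 f1 -> L4 f2 -> L4 f3 -> L4 f4 ->
  integrableC P (fun w => f1 w * f2 w * f3 w * f4 w).
Proof.
move=> L1 L2 L3 L4'.
have ih := integrableD measurableT
  (integrableD measurableT (L4_integrable L1) (L4_integrable L2))
  (integrableD measurableT (L4_integrable L3) (L4_integrable L4')).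
apply: (dominated_integrableC _ ih).
  by move: L1 L2 L3 L4' => [? _] [? _] [? _] [? _];
    do 3?apply: measurable_funCM.
move=> w /=; rewrite !normcM.
move: (normc_ge0 (f1 w)) (normc_ge0 (f2 w)).
move: (normc_ge0 (f3 w)) (normc_ge0 (f4 w)).
move: (normc (f1 w)) (normc (f2 w)) (normc (f3 w)) (normc (f4 w)) => a b c e *.
(* By 2st <= s^2 + t^2, used twice, abce <= (a^2 b^2 + c^2 e^2) / 2 <= (a^4 + b^4 + c^4 + e^4) / 4;
   the last four squares absorb the factor 1/4. *)
have := sqr_ge0 (a * b - c * e).
have := sqr_ge0 (a ^+ 2 - b ^+ 2); have := sqr_ge0 (c ^+ 2 - e ^+ 2).
have := sqr_ge0 (a ^+ 2); have := sqr_ge0 (b ^+ 2).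
have := sqr_ge0 (c ^+ 2); have := sqr_ge0 (e ^+ 2).
lra.
Qed.

(** Padding with the constant 1, which lies in [L4] because [P] is finite, reduces two factors to
    four. *)
Lemma L4_integrableC2 f1 f2 : L4 f1 -> L4 f2 ->
  integrableC P (fun w => f1 w * f2 w).
Proof.
move=> L1 L2; have := L4_integrableC4 L1 L2 (L4_cst 1) (L4_cst 1).
by under eq_fun do rewrite !mulr1.
Qed.

Lemma L4_integrableC f : L4 f -> integrableC P f.
Proof.
move=> L1; have := L4_integrableC2 L1 (L4_cst 1).
by under eq_fun do rewrite mulr1.
Qed.

End fourth_moments.

Lemma L4_same_law d (T : measurableType d) d' (T' : measurableType d')
    (R : realType) (P : probability T R) (Q : probability T' R)
    d1 (U : measurableType d1) (x : T -> U) (y : T' -> U) (f : U -> R[i]) :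
  measurable_fun setT x -> measurable_fun setT y -> same_law P Q x y ->
  measurable_fun setT f ->
  L4 P (fun w => f (x w)) -> L4 Q (fun w => f (y w)).
Proof.
move=> mx my xy mf [_ foo]; split; first exact: measurableT_comp.
rewrite -(same_law_ge0_integral (f := fun u => (normc (f u) ^+ 4)%:E)
  mx my xy)//.
- exact/measurable_EFinP/measurable_funX/measurable_normc.
- by move=> u; rewrite lee_fin exprn_ge0// normc_ge0.
Qed.

(** * Fourth moments of unitarily invariant vectors *)

Section reflections.
Context (R : realType) (p : nat).
Local Notation C := R[i].

Lemma conjC_i : Num.conj 'i%C = - 'i%C :> C.
Proof. by apply/eqP; rewrite eq_complex /= oppr0 !eqxx. Qed.

(* Multiplies the range of the projection q by i and fixes its kernel. *)
Definition reflection_mx (q : 'M[C]_p) : 'M[C]_p := 1%:M - (1 - 'i%C) *: q.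

(** With a = 1 - i and b = 1 + i, (1 - a q) (1 - b q) = 1 - (a + b - a b) q, and a b = a + b = 2. *)
Lemma reflection_mx_unitary (q : 'M[C]_p) :
  q *m q = q -> q^t* = q -> reflection_mx q \is unitarymx.
Proof.
move=> qq qH; apply/unitarymxP; rewrite /reflection_mx.
have -> : (1%:M - (1 - 'i%C) *: q)^t* = 1%:M - (1 + 'i%C) *: q.
  rewrite linearB/= linearZ/= trmx1 map_mxB map_mx1 map_mxZ qH.
  by congr (_ - _ *: _); rewrite rmorphB rmorph1/= conjC_i opprK.
have : (1 - 'i%C) * (1 + 'i%C) = (1 + 'i%C) + (1 - 'i%C) :> C.
  by rewrite mulrBl mul1r mulrDr mulr1 -expr2 sqr_i; ring.
move: (1 - 'i%C) (1 + 'i%C) => a b ab.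
rewrite mulmxBl mul1mx mulmxBr mulmx1 -scalemxAl -scalemxAr qq scalerA ab.
by rewrite scalerDl opprB addrK subrK.
Qed.

(** [x'] and [y'] play the conjugates of [x] and [y] but are free variables, so that the identity is
    purely polynomial; [a] is a coordinate after the unitary and [b] its conjugate. The factor 16
    clears four halves. The right-nested sum ending in 0 is the shape in which [big_cons] unfolds
    the list of monomials in [moment4_rotation]. *)
Lemma rotation_expansion (x y x' y' : C) :
  let a := x - (1 - 'i%C) * (2^-1 * (x - y)) in
  let b := x' - (1 + 'i%C) * (2^-1 * (x' - y')) in
  16 * (a * b * b * a) =
  4 * (x * x' * x' * x) + (8 * 'i%C * (x * x' * y' * x) +
  (- 4 * (x * y' * y' * x) + (- (8 * 'i%C) * (x * x' * x' * y) +
  (16 * (x * x' * y' * y) + (8 * 'i%C * (x * y' * y' * y) +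
  (- 4 * (y * x' * x' * y) + (- (8 * 'i%C) * (y * x' * y' * y) +
  (4 * (y * y' * y' * y) + 0)))))))).
Proof.
(* Since a = ((x + y) + i (x - y)) / 2 and b = ((x' + y') - i (x' - y')) / 2, one has 4ab = A + i B
   with [A] and [B] free of i. *)
pose A := (x + y) * (x' + y') + (x - y) * (x' - y').
pose B := (x - y) * (x' + y') - (x + y) * (x' - y').
have i2 : 'i%C * 'i%C = -1 :> C by rewrite -expr2 sqr_i.
move=> a b; have ab : 4 * (a * b) = A + 'i%C * B.
  transitivity ((x + y) * (x' + y') -
    ('i%C * 'i%C) * ((x - y) * (x' - y')) + 'i%C * B); last first.
    by rewrite i2 /A; ring.
  by rewrite /a /b /B; field.
transitivity ((A + 'i%C * B) * (A + 'i%C * B)).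
  by rewrite -ab; ring.
transitivity (A * A + ('i%C * 'i%C) * (B * B) + 2 * 'i%C * A * B).
  by ring.
by rewrite i2 /A /B; ring.
Qed.

End reflections.

Lemma measurable_mulmx_cst (R : realType) m p (V : 'M[R[i]]_(m, p)) :
  measurable_fun setT (fun x : 'cV[R[i]]_p => V *m x).
Proof.
apply: measurable_fun_matrix => i j; under eq_fun do rewrite mxE.
apply: measurable_funC_sum => k; apply: measurable_funCM => //.
exact: measurable_coord.
Qed.

Section spherical_moments.
Context d (T : measurableType d) (R : realType) (P : probability T R) (p : nat).
Local Notation C := R[i].
Context (v : T -> 'cV[C]_p).
Hypothesis mv : measurable_fun setT v.
Hypothesis Lv : forall i, L4 P (fun w => v w i 0).
Hypothesis invv : forall V : 'M[C]_p, V \is unitarymx ->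
  same_law P P (fun w => V *m v w) v.

Lemma expectC_unitary (V : 'M[C]_p) (f : 'cV[C]_p -> C) : V \is unitarymx ->
  measurable_fun setT f ->
  expectC P (fun w => f (V *m v w)) = expectC P (fun w => f (v w)).
Proof.
move=> uV mf; apply: (same_law_expectC _ mv (invv uV) mf).
exact: (measurableT_comp (measurable_mulmx_cst V) mv).
Qed.

(** The conjugation pattern is that of an entry of S times the conjugate of another entry, the
    product behind a covariance of entries. *)
Definition moment4 i j k l : C := expectC P (fun w =>
  v w i 0 * Num.conj (v w j 0) * Num.conj (v w k 0) * v w l 0).

Let m4 (i j k l : 'I_p) : measurable_fun setT (fun x : 'cV[C]_p =>
  x i 0 * Num.conj (x j 0) * Num.conj (x k 0) * x l 0).
Proof.
have mc i' : measurable_fun setT (fun x : 'cV[C]_p => x i' 0).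
  exact: measurable_coord.
by do 3?apply: measurable_funCM => //; exact: measurable_fun_conj.
Qed.

Let int4 i j k l : integrableC P (fun w =>
  v w i 0 * Num.conj (v w j 0) * Num.conj (v w k 0) * v w l 0).
Proof. by apply: L4_integrableC4 => //; exact: L4_conj. Qed.

(** The unitary for q = 1 is multiplication by i, so the expectation e satisfies e = i^2 e = -e. *)
Lemma spherical_moment2 i j : expectC P (fun w => v w i 0 * v w j 0) = 0.
Proof.
have uV : reflection_mx (1%:M : 'M[C]_p) \is unitarymx.
  by apply: reflection_mx_unitary; rewrite ?mulmx1// trmx1 map_mx1.
have iv w k : (reflection_mx 1%:M *m v w) k 0 = 'i%C * v w k 0.
  by rewrite mulmxBl mul1mx -scalemxAl mul1mx !mxE; ring.
have mf : measurable_fun setT (fun x : 'cV[C]_p => x i 0 * x j 0).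
  by apply: measurable_funCM; exact: measurable_coord.
have := expectC_unitary uV mf.
under eq_fun do rewrite !iv mulrACA -expr2 sqr_i.
rewrite expectCZ ?mulN1r; last exact: L4_integrableC2.
set e := expectC _ _ => e0.
have : 2 * e = 0 by rewrite mulr_natl mulr2n -{1}e0 addNr.
by move/eqP; rewrite mulf_eq0 pnatr_eq0/= => /eqP.
Qed.

(** Diagonal entry [n] of the unitary [reflection_mx (delta_mx m m)]. *)
Definition phase (m n : 'I_p) : C := if n == m then 'i%C else 1.

Lemma moment4_phase m i j k l : moment4 i j k l =
  phase m i * Num.conj (phase m j) * Num.conj (phase m k) * phase m l *
  moment4 i j k l.
Proof.
pose c := phase m; pose q : 'M[C]_p := delta_mx m m.
have uV : reflection_mx q \is unitarymx.
  apply: reflection_mx_unitary; first by rewrite mul_delta_mx.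
  by rewrite trmx_delta map_delta_mx.
have iv w n : (reflection_mx q *m v w) n 0 = c n * v w n 0.
  rewrite mulmxBl mul1mx -scalemxAl !mxE (bigD1 m)//=.
  rewrite big1 => [|n' nm]; last first.
    by rewrite mxE (negbTE nm) andbF mul0r.
  by rewrite mxE eqxx andbT /c /phase; case: eqP => [->|_] /=; ring.
rewrite {1}/moment4; have /= <- := expectC_unitary uV (m4 i j k l).
rewrite -expectCZ//; congr expectC; apply/funext => w.
by rewrite !iv !rmorphM /c; ring.
Qed.

(** It suffices to find one [m] for which the scalar in [moment4_phase] differs from 1. *)
Lemma moment4_eq0 i j k l : ~~ ((i == j) && (k == l)) ->
  ~~ ((i == k) && (j == l)) -> moment4 i j k l = 0.
Proof.
move=> nijkl nikjl.
have phase0 m (z : C) : z != 1 ->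
    phase m i * Num.conj (phase m j) * Num.conj (phase m k) * phase m l = z ->
    moment4 i j k l = 0.
  move=> z1 cz; have := moment4_phase m i j k l; rewrite cz.
  move/eqP; rewrite -{1}[moment4 i j k l]mul1r -subr_eq0 -mulrBl mulf_eq0.
  by rewrite subr_eq0 eq_sym (negbTE z1) => /eqP.
have i1 : 'i%C != 1 :> C by rewrite eq_complex /= oner_eq0 andbF.
(* Here k differs from l. The phases at positions i and j cancel, and [m] = l leaves the scalar i.
   The case i = k below is the same with j and k exchanged. *)
have [ij|ij] := eqVneq i j.
  rewrite ij eqxx /= in nijkl; rename nijkl into kl.
  apply: (phase0 l _ i1); rewrite /phase ij eqxx (negbTE kl) conjC1 mulr1.
  by case: (j == l); rewrite ?conjC1 ?conjC_i ?mul1r//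
    mulrN -expr2 sqr_i opprK mul1r.
have [ik|ik] := eqVneq i k.
  rewrite ik eqxx /= in nikjl; rename nikjl into jl.
  apply: (phase0 l _ i1); rewrite /phase ik eqxx (negbTE jl) conjC1 mulr1.
  by case: (k == l); rewrite ?conjC1 ?conjC_i ?mul1r//
    mulrN -expr2 sqr_i opprK mul1r.
(* Now i differs from j and from k, so [m] = i gives i^2 = -1 if l = i and i otherwise. The first
   alternative removes the pairing i = l, j = k. *)
have [il|il] := eqVneq l i.
  apply: (phase0 i (-1)); last first.
    rewrite /phase eqxx il eqxx eq_sym (negbTE ij) eq_sym (negbTE ik).
    by rewrite conjC1 !mulr1 -expr2 sqr_i.
  by rewrite -subr_eq0 -opprD oppr_eq0 (_ : 1 + 1 = 2%:R) ?pnatr_eq0.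
apply: (phase0 i _ i1).
rewrite /phase eqxx eq_sym (negbTE ij) eq_sym (negbTE ik) (negbTE il).
by rewrite conjC1 !mulr1.
Qed.

(** The unitary mixes coordinates i and j; the fourth absolute moment of the new coordinate expands
    into nine monomials, six of which vanish by [moment4_eq0]. *)
Lemma moment4_rotation i j : i != j ->
  16 * moment4 i i i i =
  4 * moment4 i i i i + 4 * moment4 j j j j + 16 * moment4 i i j j.
Proof.
move=> ij; have ji : j != i by rewrite eq_sym.
pose u : 'cV[C]_p := delta_mx i 0 - delta_mx j 0.
(* The factor 1/2 compensates u^T u = 2; [u] is real, so its transpose serves as conjugate
   transpose. *)
pose q := 2^-1 *: (u *m u^T).
have uT : u^T = delta_mx 0 i - delta_mx 0 j.
  by rewrite /u linearB /= !trmx_delta.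
have uu : u^T *m u = 2%:M.
  rewrite uT /u mulmxBl !mulmxBr !mul_delta_mx_cond.
  rewrite !eqxx (negbTE ij) (negbTE ji) !mulr0n !mulr1n subr0 sub0r opprK.
  by apply/matrixP => k l; rewrite !ord1 !mxE.
have uV : reflection_mx q \is unitarymx.
  apply: reflection_mx_unitary.
    rewrite /q -scalemxAl -scalemxAr scalerA mulmxA -(mulmxA u) uu.
    by rewrite mul_mx_scalar -scalemxAl scalerA -mulrA mulVf ?mulr1.
  rewrite /q linearZ/= map_mxZ trmx_mul trmxK; congr (_ *: _).
    by rewrite fmorphV rmorph_nat.
  by rewrite map_mxM uT /u !map_mxB !map_delta_mx.
have iv w : (reflection_mx q *m v w) i 0 =
    v w i 0 - (1 - 'i%C) * (2^-1 * (v w i 0 - v w j 0)).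
  rewrite mulmxBl mul1mx -scalemxAl 2!mxE [in X in _ + X]mxE; congr (_ - _ * _).
  rewrite /q -scalemxAl mxE -mulmxA; congr (_ * _).
  rewrite uT (mulmxBl (delta_mx 0 i)) -!rowE.
  rewrite mxE big_ord1 !mxE !eqxx (negbTE ij) /=.
  by rewrite subr0 mul1r.
have conj_y (x y : C) : Num.conj (x - (1 - 'i%C) * (2^-1 * (x - y))) =
    Num.conj x - (1 + 'i%C) * (2^-1 * (Num.conj x - Num.conj y)).
  rewrite rmorphB rmorphM rmorphM !rmorphB rmorph1 fmorphV rmorph_nat /=.
  by rewrite conjC_i opprK.
(* Coefficients and index quadruples of [rotation_expansion], in the same order. *)
pose s : seq (C * ('I_p * 'I_p * 'I_p * 'I_p)) :=
  [:: (4, (i, i, i, i)); (8 * 'i%C, (i, i, j, i)); (- 4, (i, j, j, i));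
      (- (8 * 'i%C), (i, i, i, j)); (16, (i, i, j, j));
      (8 * 'i%C, (i, j, j, j)); (- 4, (j, i, i, j));
      (- (8 * 'i%C), (j, i, j, j)); (4, (j, j, j, j))].
pose mon (t : 'I_p * 'I_p * 'I_p * 'I_p) w :=
  v w t.1.1.1 0 * Num.conj (v w t.1.1.2 0) * Num.conj (v w t.1.2 0) * v w t.2 0.
have sE : 16 * moment4 i i i i = \sum_(t <- s) t.1 * expectC P (mon t.2).
  rewrite {1}/moment4; have /= <- := expectC_unitary uV (m4 i i i i).
  have int_rot : integrableC P (fun w => (reflection_mx q *m v w) i 0 *
      Num.conj ((reflection_mx q *m v w) i 0) *
      Num.conj ((reflection_mx q *m v w) i 0) * (reflection_mx q *m v w) i 0).
    have Lr : L4 P (fun w => (reflection_mx q *m v w) i 0).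
      by under eq_fun do rewrite mxE; apply: L4_sum => k; exact: L4Z.
    by apply: L4_integrableC4 => //; exact: L4_conj.
  rewrite -expectCZ//.
  transitivity (expectC P (fun w => \sum_(t <- s) t.1 * mon t.2 w)).
    congr expectC; apply/funext => w; rewrite !iv /s !big_cons big_nil /mon /=.
    rewrite !conj_y.
    exact: rotation_expansion.
  rewrite expectC_sum; last by move=> t; apply: integrableCZ; exact: int4.
  by apply: eq_bigr => t _; rewrite expectCZ//; exact: int4.
rewrite sE /s !big_cons big_nil/= -!/(moment4 _ _ _ _).
rewrite (@moment4_eq0 i i j i) ?(@moment4_eq0 i j j i) ?(@moment4_eq0 i i i j)
  ?(@moment4_eq0 i j j j) ?(@moment4_eq0 j i i j) ?(@moment4_eq0 j i j j)
  ?(negbTE ij) ?(negbTE ji) ?andbF//.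
by ring.
Qed.

Lemma moment4C i j : moment4 i i j j = moment4 j j i i.
Proof. by rewrite /moment4; congr expectC; apply/funext => w; ring. Qed.

(** The right-hand side of [moment4_rotation] is symmetric in i and j, so its two instances have
    equal left-hand sides. *)
Lemma moment4_diag i j : moment4 i i i i = moment4 j j j j.
Proof.
have [->//|ij] := eqVneq i j.
have h1 := moment4_rotation ij; rewrite eq_sym in ij.
have := moment4_rotation ij; rewrite (moment4C j i) => h2.
apply/eqP; rewrite -subr_eq0; apply/eqP.
have /mulfI : (16 : C) != 0 by rewrite pnatr_eq0.
by apply; rewrite mulrBr h1 h2; ring.
Qed.

Lemma moment4_cross i j : i != j -> moment4 i i i i = 2 * moment4 i i j j.
Proof.
move=> ij; have := moment4_rotation ij; rewrite -(moment4_diag i j) => h.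
have /mulfI : (8 : C) != 0 by rewrite pnatr_eq0.
apply; apply: (addrI (8 * moment4 i i i i)).
transitivity (16 * moment4 i i i i); first by ring.
by rewrite h; ring.
Qed.

(** E ||v||^4, kept complex-valued so that it expands directly into values of [moment4]. *)
Definition radial4 : C :=
  expectC P (fun w => (\sum_i v w i 0 * Num.conj (v w i 0)) ^+ 2).

Lemma radial4E : radial4 = \sum_i \sum_j moment4 i i j j.
Proof.
rewrite /radial4.
rewrite -(eq_bigr _ (fun i _ => expectC_sum _ (fun j => int4 i i j j))).
rewrite -expectC_sum; last by move=> i; exact: integrableC_sum.
congr expectC; apply/funext => w; rewrite expr2 mulr_suml.
apply: eq_bigr => i _; rewrite mulr_sumr; apply: eq_bigr => j _; ring.
Qed.

Lemma spherical_moment4 i j k l : moment4 i j k l =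
  radial4 / (p%:R * (p%:R + 1)) *
  (((i == j) && (k == l))%:R + ((i == k) && (j == l))%:R).
Proof.
pose a := moment4 i i i i.
have p0 : (0 < p)%N := leq_ltn_trans (leq0n i) (ltn_ord i).
(* Everything is expressed through a = E|v_i|^4. Summing this identity over m and n gives 2 E||v||^4
   = a p (p + 1), so the constant in the claim is a / 2. *)
have E m n : 2 * moment4 m m n n = a * (1 + (m == n)%:R).
  have [->|mn] := eqVneq m n.
    by rewrite /a (moment4_diag n i) /=; ring.
  by rewrite -moment4_cross// /a (moment4_diag m i) /=; ring.
have radE : 2 * radial4 = a * (p%:R * (p%:R + 1)).
  rewrite radial4E mulr_sumr.
  transitivity (\sum_(m < p) a * (p%:R + 1)).
    apply: eq_bigr => m _; rewrite mulr_sumr.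
    rewrite (eq_bigr (fun n => a * (1 + (m == n)%:R)))//.
    rewrite -mulr_sumr big_split/= sumr_const card_ord.
    rewrite (bigD1 m)//= eqxx big1 ?addr0// => n nm.
    by rewrite eq_sym (negbTE nm).
  by rewrite sumr_const card_ord -[LHS]mulr_natl; ring.
have -> : radial4 / (p%:R * (p%:R + 1)) = a / 2.
  have /mulfI : (2 : C) != 0 by rewrite pnatr_eq0.
  apply; rewrite mulrA radE; field.
  by rewrite natr1 !pnatr_eq0 -!lt0n p0.
have /mulfI : (2 : C) != 0 by rewrite pnatr_eq0.
apply; rewrite (_ : 2 * (a / 2 * _) = a *
  (((i == j) && (k == l))%:R + ((i == k) && (j == l))%:R)); last by field.
case: (boolP ((i == j) && (k == l))) => [/andP[/eqP<- /eqP<-]|h1].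
  by rewrite E andbb; case: eqP => _ /=; ring.
case: (boolP ((i == k) && (j == l))) => [/andP[/eqP ik /eqP jl]|h2]; last first.
  by rewrite moment4_eq0// /= addr0 !mulr0.
rewrite -ik -jl (_ : moment4 i j i j = moment4 i i j j).
  rewrite E; move: h1; rewrite -ik -jl andbb.
  by move=> /negbTE; rewrite eq_sym => ->/=; ring.
by rewrite /moment4; congr expectC; apply/funext => w; ring.
Qed.

End spherical_moments.

(** * Elliptical distributions *)

Section posdef.
Context (R : realType) (p : nat).
Local Notation C := R[i].

Lemma hermsymmxE (A : 'M[C]_p) : A \is hermsymmx ->
  forall i j, Num.conj (A i j) = A j i.
Proof.
move=> /is_hermitianmxP AE i j.
by rewrite [A in LHS]AE expr0 scale1r !mxE conjCK.
Qed.

(** A nonzero row v with v A = 0 would make the quadratic form vanish at v^H. *)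
Lemma posdefmx_unit (A : 'M[C]_p) : posdefmx A -> A \in unitmx.
Proof.
move=> [_ Apos]; rewrite -row_free_unit -kermx_eq0; apply/negPn/negP.
move=> /rowV0Pn[v /sub_kermxP vA v0].
have vH0 : v^t* != 0.
  apply: contra_neq v0 => vH0; rewrite -[v]trmxK -[v^T](map_mxCK).
  by rewrite vH0 map_mx0 trmx0.
have := Apos _ vH0.
rewrite map_trmx trmxK (_ : map_mx _ (map_mx _ v) = v); last first.
  by apply/matrixP => i j; rewrite !mxE conjCK.
by rewrite vA mul0mx mxE ltxx.
Qed.

End posdef.

Section scaled_sphere.
Context d (T : measurableType d) (R : realType) (Q : probability T R) (p : nat).
Local Notation C := R[i].
Context (r : {RV Q >-> R}) (u : {RV Q >-> 'cV[C]_p}).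
Hypotheses (usph : uniform_sphere u) (ru : independent2 r u).

Definition scaled (w : T) : 'cV[C]_p := (r w)%:C *: u w.

Let mu_coord i : measurable_fun setT (fun w => u w i 0).
Proof.
exact: (measurableT_comp (measurable_coord i 0) (measurable_funPT u)).
Qed.

Let mr : measurable_fun setT r. Proof. exact: measurable_funPT. Qed.

Lemma measurable_scaled : measurable_fun setT scaled.
Proof.
apply: measurable_fun_matrix => i j; rewrite ord1.
under eq_fun do rewrite mxE.
by apply: measurable_funCM => //; exact: measurable_fun_real_complex.
Qed.

Lemma scaled_coord_measurable i : measurable_fun setT (fun w => scaled w i 0).
Proof.
exact: (measurableT_comp (measurable_coord i 0) measurable_scaled).
Qed.

(** Independence makes the invariance of [u] a joint one: (r, V u) and (r, u) both have the product
    of the laws of [r] and [u] as joint law, and scaling is a measurable function of the pair that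
    commutes with [V]. *)
Lemma scaled_invariant (V : 'M[C]_p) : V \is unitarymx ->
  same_law Q Q (fun w => V *m scaled w) scaled.
Proof.
move=> uV B mB.
have mVu : measurable_fun setT (fun w => V *m u w).
  exact: (measurableT_comp (measurable_mulmx_cst V) (measurable_funPT u)).
have mp (y : T -> 'cV[C]_p) : measurable_fun setT y ->
    measurable_fun setT (fun w => (r w, y w)).
  by move=> my; exact/measurable_fun_pairP.
have law (y : T -> 'cV[C]_p) (my : measurable_fun setT y) :
    (forall D, measurable D -> Q (y @^-1` D) = Q (u @^-1` D)) ->
    (forall A D, measurable A -> measurable D ->
      Q (r @^-1` A `&` y @^-1` D) = (Q (r @^-1` A) * Q (y @^-1` D))%E) ->
    forall D, measurable D -> Q ((fun w => (r w, y w)) @^-1` D) =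
      (distribution Q r \x distribution Q u)%E D.
  move=> yu yind D mD.
  pose Y : {mfun T >-> (R * 'cV[C]_p)%type} :=
    HB.pack (fun w => (r w, y w)) (isMeasurableFun.Build _ _ _ _ _ (mp _ my)).
  rewrite (@product_measure_unique _ _ _ _ _ _ _ (distribution Q Y))//.
  move=> A E mA mE.
  transitivity (Q (r @^-1` A `&` y @^-1` E)) => //.
  by rewrite yind// yu.
pose sc (t : R * 'cV[C]_p) := t.1%:C *: t.2.
have msc : measurable_fun setT sc.
  apply: measurable_fun_matrix => i j; under eq_fun do rewrite mxE.
  apply: measurable_funCM; first by apply: measurable_fun_real_complex;
    exact: measurable_fst.
  exact: (measurableT_comp (measurable_coord i j) measurable_snd).
have mscB : measurable (sc @^-1` B).
  by rewrite -[X in measurable X]setTI; exact: msc.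
have lawV : forall D, measurable D ->
    Q ((fun w => V *m u w) @^-1` D) = Q (u @^-1` D).
  by move=> D mD; exact: (usph.2 V D uV mD).
transitivity ((distribution Q r \x distribution Q u)%E (sc @^-1` B)).
  rewrite -(law _ mVu lawV _ _ mscB).
    congr (Q _); apply/funext => w; rewrite /preimage /= /scaled /sc /=.
    by rewrite -scalemxAr.
  move=> A D mA mD; rewrite -[_ @^-1` D]/(u @^-1` ((fun x => V *m x) @^-1` D)).
  apply: ru => //; rewrite -[X in measurable X]setTI.
  exact: measurable_mulmx_cst.
rewrite -(law u _ _ _ _ mscB)//.
Qed.

Lemma sphere_norm : {ae Q, forall w, \sum_i u w i 0 * Num.conj (u w i 0) = 1}.
Proof.
apply: filterS usph.1 => w; rewrite /frobenius.
rewrite (eq_bigr (fun i => normc (u w i 0) ^+ 2)) => [|i _].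
  2: by rewrite big_ord1.
move=> u1; transitivity (\sum_i normc (u w i 0) ^+ 2)%:C.
  by rewrite rmorph_sum; apply: eq_bigr => i _; rewrite /= mulC_conj_normc.
congr (_%:C); rewrite -[LHS]sqr_sqrtr ?u1 ?expr1n//.
by apply: sumr_ge0 => i _; rewrite sqr_ge0.
Qed.

Lemma scaled_normE w : \sum_i u w i 0 * Num.conj (u w i 0) = 1 ->
  \sum_i scaled w i 0 * Num.conj (scaled w i 0) = (r w ^+ 2)%:C.
Proof.
move=> u1; rewrite -[RHS]mulr1 -u1 mulr_sumr; apply: eq_bigr => i _.
by rewrite !mxE rmorphM/= conjC_real rmorphXn/=; ring.
Qed.

Lemma radial4_scaled : radial4 Q scaled = (fine 'E_Q[fun w => r w ^+ 4])%:C.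
Proof.
transitivity (expectC Q (fun w => (r w ^+ 4)%:C)).
  apply: expectC_ae.
  - under eq_fun do rewrite expr2.
    by apply: measurable_funCM; apply: measurable_funC_sum => i;
      apply: measurable_funCM; rewrite ?(measurable_fun_conj _)//;
      do ?apply: measurable_fun_conj; exact: scaled_coord_measurable.
  - by apply: measurable_fun_real_complex; exact: measurable_funX.
  - apply: filterS sphere_norm => w /scaled_normE ->.
    by rewrite -rmorphXn/= -exprM.
by rewrite expectCE /= Rintegral_cst//= mul0r unlock.
Qed.

(** Almost everywhere r^4 = ||v||^4, a finite sum of products of four coordinates in [L4]. *)
Lemma scaled_L4_radius : (forall i, L4 Q (fun w => scaled w i 0)) ->
  ('E_Q[fun w => (r w ^+ 4)%R] < +oo)%E.
Proof.
move=> Lv; rewrite unlock.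
have : integrableC Q (fun w =>
    \sum_i \sum_j (scaled w i 0 * Num.conj (scaled w i 0) *
                   Num.conj (scaled w j 0) * scaled w j 0)).
  apply: integrableC_sum => i; apply: integrableC_sum => j.
  by apply: L4_integrableC4 => //; exact: L4_conj.
case=> /integrableP[mI +] _; apply: le_lt_trans.
apply: ae_ge0_le_integral => //.
- by move=> w _; rewrite lee_fin exprn_even_ge0.
- by apply/measurable_EFinP; exact: measurable_funX.
- exact: measurableT_comp.
apply: filterS sphere_norm => w /scaled_normE vr _; rewrite lee_fin.
have -> : \sum_i \sum_j (scaled w i 0 * Num.conj (scaled w i 0) *
    Num.conj (scaled w j 0) * scaled w j 0) = (r w ^+ 4)%:C.
  rewrite -[4%N]/(2 + 2)%N exprD rmorphM/= -vr mulr_suml.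
  apply: eq_bigr => i _; rewrite mulr_sumr; apply: eq_bigr => j _.
  ring.
exact: ler_norm.
Qed.

(** Almost everywhere |v_i|^2 <= ||v||^2 = r^2. *)
Lemma radius_scaled_L4 : ('E_Q[fun w => (r w ^+ 4)%R] < +oo)%E ->
  forall i, L4 Q (fun w => scaled w i 0).
Proof.
rewrite unlock => roo i; split; first exact: scaled_coord_measurable.
apply: le_lt_trans roo; apply: ae_ge0_le_integral => //.
- by move=> w _; rewrite lee_fin exprn_ge0// normc_ge0.
- by apply/measurable_EFinP/measurable_funX/measurable_normc;
    exact: scaled_coord_measurable.
- by move=> w _; rewrite lee_fin exprn_even_ge0.
- by apply/measurable_EFinP; exact: measurable_funX.
apply: filterS sphere_norm => w /scaled_normE vr _; rewrite lee_fin.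
have : normc (scaled w i 0) ^+ 2 <= r w ^+ 2.
  rewrite -lecR -vr mulC_conj_normc (bigD1 i)//= lerDl sumr_ge0// => j _.
  exact: mul_conjC_ge0.
by rewrite -[4%N]/(2 * 2)%N !exprM => ?; rewrite lerXn2r ?nnegrE ?sqr_ge0.
Qed.

End scaled_sphere.

(** Contracts a fourth-order form along the two pairings produced by [spherical_moment4]. *)
Lemma sum4_delta (C : comPzRingType) p (a b c e : 'I_p -> C) :
  \sum_i \sum_j \sum_k \sum_l a i * b j * c k * e l *
    (((i == j) && (k == l))%:R + ((i == k) && (j == l))%:R) =
  (\sum_i a i * b i) * (\sum_k c k * e k) +
  (\sum_i a i * c i) * (\sum_j b j * e j).
Proof.
have delta (I : 'I_p) (F : 'I_p -> C) : \sum_l F l * (I == l)%:R = F I.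
  rewrite (bigD1 I)//= eqxx mulr1 big1 ?addr0// => l lI.
  by rewrite eq_sym (negbTE lI) mulr0.
rewrite !mulr_suml -big_split; apply: eq_bigr => i _ /=.
transitivity (\sum_j (\sum_k (a i * b j * c k * e k) * (i == j)%:R +
                      \sum_k (a i * b j * c k * e j) * (i == k)%:R)).
  apply: eq_bigr => j _; rewrite -big_split; apply: eq_bigr => k _ /=.
  under eq_bigr do rewrite mulrDr -!mulnb !natrM !mulrA.
  rewrite big_split/=; congr (_ + _).
    under eq_bigr do rewrite mulrAC.
    rewrite -mulr_suml delta //.
  rewrite -(delta j (fun l => a i * b j * c k * e l * (i == k)%:R)).
  by [].
rewrite big_split/=; congr (_ + _).
  under eq_bigr do rewrite -mulr_suml.
  rewrite delta mulr_sumr; apply: eq_bigr => k _; ring.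
under eq_bigr do rewrite delta.
by rewrite mulr_sumr; apply: eq_bigr => j _; ring.
Qed.

Section ces_moments.
Context d (T : measurableType d) (R : realType) (P : probability T R).
Context d' (T' : measurableType d') (Q : probability T' R) (p : nat).
Local Notation C := R[i].
Context (r : {RV Q >-> R}) (mu : 'cV[C]_p) (Sigma : 'M[C]_p) (g : R -> R).
Context (x : {RV P >-> 'cV[C]_p}).
Hypothesis cesx : ces r mu Sigma g x.

Lemma ces_hermitian i j : Num.conj (Sigma i j) = Sigma j i.
Proof. by have [] := ces_scatter cesx => /hermsymmxE. Qed.

Lemma RV_coord_measurable a : measurable_fun setT (fun w => x w a 0).
Proof.
exact: (measurableT_comp (measurable_coord a 0) (measurable_funPT x)).
Qed.

Lemma ces_scaledP : exists (u : {RV Q >-> 'cV[C]_p}) (A : 'M[C]_p),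
  [/\ uniform_sphere u, independent2 r u, posdefmx A, A *m A = Sigma &
      same_law P Q x (fun w => mu + A *m scaled r u w)].
Proof.
have [u [A [us ru pA AA law]]] := ces_stochastic cesx.
exists u, A; split=> // B mB; rewrite law//; congr (Q _).
by apply/seteqP; split => w; rewrite /= /scaled scalemxAr.
Qed.

Lemma measurable_affine (u : {RV Q >-> 'cV[C]_p}) (A : 'M[C]_p) :
  measurable_fun setT (fun w => mu + A *m scaled r u w).
Proof.
have mAv := measurableT_comp (measurable_mulmx_cst A) (measurable_scaled r u).
apply: measurable_fun_matrix => i j; under eq_fun do rewrite mxE.
apply: measurable_funCD => //.
exact: (measurableT_comp (measurable_coord i j) mAv).
Qed.

(** In law v = A^-1 (x - mu), whose coordinates are affine in those of [x]. The conclusion involves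
    [r] only and so serves every sample with this modular variate. *)
Lemma ces_radius_finite : (forall a, L4 P (fun w => x w a 0)) ->
  ('E_Q[fun w => (r w ^+ 4)%R] < +oo)%E.
Proof.
move=> Lx; have [u [A [us ru pA AA law]]] := ces_scaledP.
apply: (scaled_L4_radius us) => i.
pose f (y : 'cV[C]_p) := \sum_k invmx A i k * (y k 0 - mu k 0).
have mf : measurable_fun setT f.
  apply: measurable_funC_sum => k; apply: measurable_funCM => //.
  by apply: measurable_funCD => //; exact: measurable_coord.
have Lf : L4 P (fun w => f (x w)).
  apply: L4_sum => k; apply: L4Z; apply: L4B => //; exact: L4_cst.
have := L4_same_law (measurable_funPT x) (measurable_affine u A) law mf Lf.
congr L4; apply/funext => w.
rewrite -[scaled r u w](mulKmx (posdefmx_unit pA)) mxE; apply: eq_bigr => k _.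
by rewrite !mxE addrAC subrr add0r (mulKmx (posdefmx_unit pA)).
Qed.

Lemma ces_L4 : ('E_Q[fun w => (r w ^+ 4)%R] < +oo)%E ->
  forall a, L4 P (fun w => x w a 0).
Proof.
move=> roo a; have [u [A [us ru pA AA law]]] := ces_scaledP.
have law' : same_law Q P (fun w => mu + A *m scaled r u w) x.
  by move=> B mB; rewrite law.
apply: (L4_same_law (f := fun y : 'cV[C]_p => y a 0) _ _ law').
- exact: measurable_affine.
- exact: measurable_funPT.
- exact: measurable_coord.
under eq_fun do rewrite !mxE.
apply: L4D; first exact: L4_cst.
by apply: L4_sum => k; apply: L4Z; exact: (radius_scaled_L4 us).
Qed.

Hypothesis roo : ('E_Q[fun w => (r w ^+ 4)%R] < +oo)%E.

Definition centered a w : C := x w a 0 - mu a 0.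

Lemma centered_L4 a : L4 P (centered a).
Proof. by apply: L4B; [exact: ces_L4|exact: L4_cst]. Qed.

Lemma centered_expect a : expectC P (centered a) = 0.
Proof.
rewrite expectCB ?expectC_cst;
  [|exact/L4_integrableC/ces_L4|exact: integrableC_cst].
by rewrite -(ces_mean cesx) mxE subrr.
Qed.

Lemma centered_cov a b :
  expectC P (fun w => centered a w * Num.conj (centered b w)) = Sigma a b.
Proof.
rewrite -(ces_var cesx) mxE; congr expectC; apply/funext => w.
by rewrite !mxE big_ord1 (ces_mean cesx) !mxE.
Qed.

Lemma centered_law (F : 'cV[C]_p -> C) : measurable_fun setT F ->
  exists (u : {RV Q >-> 'cV[C]_p}) (A : 'M[C]_p),
  [/\ uniform_sphere u, independent2 r u, A *m A = Sigma,
    (forall i j, Num.conj (A i j) = A j i) &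
    expectC P (fun w => F (x w - mu)) =
    expectC Q (fun w => F (A *m scaled r u w))].
Proof.
move=> mF; have [u [A [us ru pA AA law]]] := ces_scaledP.
exists u, A; split => //; first by have [/hermsymmxE] := pA.
have mFm : measurable_fun setT (fun y : 'cV[C]_p => F (y - mu)).
  apply: measurableT_comp => //; apply: measurable_fun_matrix => i j.
  under eq_fun do rewrite !mxE.
  by apply: measurable_funCD => //; exact: measurable_coord.
rewrite (same_law_expectC (measurable_funPT x) (measurable_affine u A) law mFm).
by congr expectC; apply/funext => w; rewrite addrAC subrr add0r.
Qed.

(** The product is bilinear in v = r u, and every E[v_i v_j] vanishes by [spherical_moment2]. *)
Lemma centered_pcov a b :
  expectC P (fun w => centered a w * centered b w) = 0.
Proof.
pose F (y : 'cV[C]_p) := y a 0 * y b 0.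
have mF : measurable_fun setT F.
  by apply: measurable_funCM; exact: measurable_coord.
have [u [A [us ru AA AH E]]] := centered_law mF.
transitivity (expectC P (fun w => F (x w - mu))).
  by congr expectC; apply/funext => w; rewrite /F !mxE.
rewrite E.
pose v := scaled r u.
have Lv := radius_scaled_L4 us roo.
have mv := measurable_scaled r u.
have iv := scaled_invariant us ru.
have int2 i j : integrableC Q (fun w => v w i 0 * v w j 0).
  exact: L4_integrableC2.
transitivity (expectC Q (fun w =>
    \sum_i \sum_j (A a i * A b j) * (v w i 0 * v w j 0))).
  congr expectC; apply/funext => w; rewrite /F !mxE mulr_suml.
  by apply: eq_bigr => i _; rewrite mulr_sumr; apply: eq_bigr => j _;
    rewrite /v; ring.
rewrite expectC_sum => [|i]; last first.
  by apply: integrableC_sum => j; exact: integrableCZ.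
rewrite big1// => i _; rewrite expectC_sum => [|j]; last exact: integrableCZ.
rewrite big1// => j _; rewrite expectCZ//.
by rewrite (spherical_moment2 mv Lv iv) mulr0.
Qed.

Lemma centered_moment4 a b c e :
  expectC P (fun w => centered a w * Num.conj (centered b w) *
                      Num.conj (centered c w) * centered e w) =
  (1 + elliptical_kurtosis Q r p)%:C *
  (Sigma a b * Num.conj (Sigma c e) + Sigma a c * Num.conj (Sigma b e)).
Proof.
pose F (y : 'cV[C]_p) :=
  y a 0 * Num.conj (y b 0) * Num.conj (y c 0) * y e 0.
have mF : measurable_fun setT F.
  have mc i : measurable_fun setT (fun y : 'cV[C]_p => y i 0).
    exact: measurable_coord.
  by do 3?apply: measurable_funCM => //; exact: measurable_fun_conj.
have [u [A [us ru AA AH E]]] := centered_law mF.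
transitivity (expectC P (fun w => F (x w - mu))).
  by congr expectC; apply/funext => w; rewrite /F !mxE.
rewrite E.
pose v := scaled r u.
have Lv := radius_scaled_L4 us roo.
have mv := measurable_scaled r u.
have iv := scaled_invariant us ru.
pose mon i j k l w :=
  v w i 0 * Num.conj (v w j 0) * Num.conj (v w k 0) * v w l 0.
have int4 i j k l : integrableC Q (mon i j k l).
  by apply: L4_integrableC4 => //; exact: L4_conj.
(* Hermitian symmetry turns the conjugates of A b j and A c k into A j b and A k c; the contracted
   sums are then entries of A A = Sigma. *)
pose coef i j k l := A a i * A j b * A k c * A e l.
transitivity (expectC Q (fun w =>
    \sum_i \sum_j \sum_k \sum_l coef i j k l * mon i j k l w)).
  congr expectC; apply/funext => w.
  rewrite /F !mxE !rmorph_sum -!mulrA mulr_suml.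
  apply: eq_bigr => i _; rewrite mulr_suml mulr_sumr; apply: eq_bigr => j _.
  rewrite mulr_suml !mulr_sumr; apply: eq_bigr => k _.
  rewrite !mulr_sumr; apply: eq_bigr => l _.
  by rewrite !rmorphM/= !AH /coef /mon /v; ring.
pose K : C := (1 + elliptical_kurtosis Q r p)%:C.
have E4 i j k l : expectC Q (fun w => coef i j k l * mon i j k l w) =
    K * (coef i j k l *
         (((i == j) && (k == l))%:R + ((i == k) && (j == l))%:R)).
  rewrite expectCZ// [expectC _ _](spherical_moment4 mv Lv iv).
  rewrite (radial4_scaled r us) mulrCA; congr (_ * _).
  rewrite /K /elliptical_kurtosis [1 + _]addrC subrK.
  rewrite fmorph_div rmorphM rmorphD/=.
  by rewrite !rmorph_nat rmorph1.
have intc i j k l := integrableCZ (coef i j k l) (int4 i j k l).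
have ints1 i j k := @integrableC_sum _ _ _ _ _ (index_enum 'I_p) _ (intc i j k).
have ints2 i j := @integrableC_sum _ _ _ _ _ (index_enum 'I_p) _ (ints1 i j).
have ints3 i := @integrableC_sum _ _ _ _ _ (index_enum 'I_p) _ (ints2 i).
rewrite expectC_sum//.
transitivity (K * \sum_i \sum_j \sum_k \sum_l coef i j k l *
   (((i == j) && (k == l))%:R + ((i == k) && (j == l))%:R)).
  rewrite mulr_sumr; apply: eq_bigr => i _; rewrite expectC_sum//.
  rewrite mulr_sumr; apply: eq_bigr => j _; rewrite expectC_sum//.
  rewrite mulr_sumr; apply: eq_bigr => k _; rewrite expectC_sum//.
  by rewrite mulr_sumr; apply: eq_bigr => l _; rewrite E4.
rewrite (sum4_delta (A a) (A^~ b) (A^~ c) (A e)).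
congr (_ * (_ * _ + _ * _));
  rewrite -AA mxE// rmorph_sum; apply: eq_bigr => i _;
  by rewrite rmorphM/= !AH mulrC.
Qed.

End ces_moments.

(** * Sample covariance matrix *)

Section sample_covariance_moments.
Context d (T : measurableType d) (R : realType) (P : probability T R).
Context d' (T' : measurableType d') (Q : probability T' R) (n p : nat).
Local Notation C := R[i].
Context (r : {RV Q >-> R}) (mu : 'cV[C]_p) (Sigma : 'M[C]_p) (g : R -> R).
Context (x : 'I_n -> {RV P >-> 'cV[C]_p}).
Hypotheses (n1 : (1 < n)%N) (indx : mutually_independent x).
Hypothesis cesx : forall i, ces r mu Sigma g (x i).
Hypothesis roo : ('E_Q[fun w => (r w ^+ 4)%R] < +oo)%E.

Local Notation kappa := (elliptical_kurtosis Q r p).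
Local Notation z i a := (centered mu (x i) a).

Let zL4 i a : L4 P (z i a).
Proof. exact: (centered_L4 (cesx i) roo). Qed.

(** * Mixed moments of centred observations *)

Section mixed_moments.
Context (a b c e : 'I_p).

(** What one observation contributes to z_i z_j^* z_k^* z_l: the Booleans tell which of the four
    positions it occupies, and a free position contributes 1. The product over all observations then
    has the form to which independence applies. *)
Definition select (bi bj bk bl : bool) (y : 'cV[C]_p) : C :=
  (if bi then y a 0 - mu a 0 else 1) *
  (if bj then Num.conj (y b 0 - mu b 0) else 1) *
  (if bk then Num.conj (y c 0 - mu c 0) else 1) *
  (if bl then y e 0 - mu e 0 else 1).

Lemma measurable_select bi bj bk bl : measurable_fun setT (select bi bj bk bl).
Proof.
have mc i (bo : bool) : measurable_fun setT
    (fun y : 'cV[C]_p => if bo then y i 0 - mu i 0 else 1).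
  by case: bo => //; apply: measurable_funCD => //; exact: measurable_coord.
have mcc i (bo : bool) : measurable_fun setT
    (fun y : 'cV[C]_p => if bo then Num.conj (y i 0 - mu i 0) else 1).
  case: bo => //; apply: measurable_fun_conj; exact: (mc i true).
by do 3?apply: measurable_funCM.
Qed.

Lemma integrable_select bi bj bk bl m :
  integrableC P (fun w => select bi bj bk bl (x m w)).
Proof.
have Lc i (bo : bool) : L4 P (fun w => if bo then x m w i 0 - mu i 0 else 1).
  by case: bo; [exact: zL4|exact: L4_cst].
have Lcc i (bo : bool) :
    L4 P (fun w => if bo then Num.conj (x m w i 0 - mu i 0) else 1).
  by case: bo; [exact/L4_conj/zL4|exact: L4_cst].
exact: L4_integrableC4.
Qed.

Definition select_moment m bi bj bk bl : C :=
  expectC P (fun w => select bi bj bk bl (x m w)).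

Lemma expectC_select (bi bj bk bl : pred 'I_n) :
  expectC P (fun w => \prod_m select (bi m) (bj m) (bk m) (bl m) (x m w)) =
  \prod_m select_moment m (bi m) (bj m) (bk m) (bl m).
Proof.
apply: (mutually_independent_expectC indx
  (f := fun m => select (bi m) (bj m) (bk m) (bl m))) => m.
  exact: measurable_select.
exact: integrable_select.
Qed.

Lemma select_moment_none m : select_moment m false false false false = 1.
Proof. by rewrite /select_moment /select !mulr1 expectC_cst. Qed.

Lemma select_moment_i m : select_moment m true false false false = 0.
Proof.
rewrite -(centered_expect (cesx m) roo a); congr expectC; apply/funext => w.
by rewrite /select !mulr1.
Qed.

Lemma select_moment_l m : select_moment m false false false true = 0.
Proof.
rewrite -(centered_expect (cesx m) roo e); congr expectC; apply/funext => w.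
by rewrite /select !mul1r.
Qed.

Lemma select_moment_j m : select_moment m false true false false = 0.
Proof.
transitivity (Num.conj (expectC P (z m b))).
  rewrite -expectC_conj; last exact: L4_integrableC.
  by congr expectC; apply/funext => w; rewrite /select !mulr1 mul1r.
by rewrite (centered_expect (cesx m) roo) conjC0.
Qed.

Lemma select_moment_k m : select_moment m false false true false = 0.
Proof.
transitivity (Num.conj (expectC P (z m c))).
  rewrite -expectC_conj; last exact: L4_integrableC.
  by congr expectC; apply/funext => w; rewrite /select mulr1 !mul1r.
by rewrite (centered_expect (cesx m) roo) conjC0.
Qed.

Lemma select_moment_ij m : select_moment m true true false false = Sigma a b.
Proof.
rewrite -(centered_cov (cesx m)); congr expectC; apply/funext => w.
by rewrite /select !mulr1.
Qed.

Lemma select_moment_ik m : select_moment m true false true false = Sigma a c.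
Proof.
rewrite -(centered_cov (cesx m)); congr expectC; apply/funext => w.
by rewrite /select !mulr1.
Qed.

Lemma select_moment_kl m :
  select_moment m false false true true = Num.conj (Sigma c e).
Proof.
rewrite (ces_hermitian (cesx m)) -(centered_cov (cesx m)).
by congr expectC; apply/funext => w; rewrite /select !mul1r mulrC.
Qed.

Lemma select_moment_jl m :
  select_moment m false true false true = Num.conj (Sigma b e).
Proof.
rewrite (ces_hermitian (cesx m)) -(centered_cov (cesx m)).
by congr expectC; apply/funext => w; rewrite /select mul1r mulr1 mulrC.
Qed.

Lemma select_moment_il m : select_moment m true false false true = 0.
Proof.
rewrite -(centered_pcov (cesx m) roo a e); congr expectC; apply/funext => w.
by rewrite /select !mulr1.
Qed.

Lemma select_moment_all m : select_moment m true true true true =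
  (1 + kappa)%:C *
  (Sigma a b * Num.conj (Sigma c e) + Sigma a c * Num.conj (Sigma b e)).
Proof. exact: (centered_moment4 (cesx m) roo). Qed.

(** An observation in a single position contributes a zero mean, one in positions i and l a zero
    pseudo-covariance. When all four indices agree, both pairing terms are present and account for
    the 1 in 1 + kappa, so that only kappa is left for the last term. *)
Lemma centered_mixed_moment i j k l :
  expectC P (fun w => z i a w * Num.conj (z j b w) *
                      Num.conj (z k c w) * z l e w) =
  ((i == j) && (k == l))%:R * (Sigma a b * Num.conj (Sigma c e)) +
  ((i == k) && (j == l))%:R * (Sigma a c * Num.conj (Sigma b e)) +
  [&& i == j, i == k & i == l]%:R * (kappa%:C *
    (Sigma a b * Num.conj (Sigma c e) + Sigma a c * Num.conj (Sigma b e))).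
Proof.
transitivity (\prod_m select_moment m (i == m) (j == m) (k == m) (l == m)).
  rewrite -expectC_select; congr expectC; apply/funext => w.
  rewrite /select !big_split/=.
  have prod1 q (F : 'I_n -> C) : \prod_m (if q == m then F m else 1) = F q.
    by rewrite -big_mkcond (big_pred1 q)// => m; rewrite eq_sym.
  by rewrite !prod1.
have zero m : select_moment m (i == m) (j == m) (k == m) (l == m) = 0 ->
    \prod_m select_moment m (i == m) (j == m) (k == m) (l == m) = 0.
  by move=> m0; rewrite (bigD1 m)//= m0 mul0r.
have [ij|ij] := eqVneq i j; last first.
  have ji : j != i by rewrite eq_sym.
  rewrite !mul0r add0r addr0.
  have [ik|ik] := eqVneq i k; last first.
    have ki : k != i by rewrite eq_sym.
    rewrite mul0r.
    (* Neither j nor k equals i. If l differs too, i stands alone; otherwise j stands alone or j =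
       k, the pairing with zero pseudo-covariance. *)
    have [il|li] := eqVneq l i; last first.
      apply: (zero i); rewrite eqxx (negbTE ji) (negbTE ki) (negbTE li).
      exact: select_moment_i.
    rewrite il in zero *; have [jk|kj] := eqVneq k j; last first.
      apply: (zero j); rewrite eqxx (negbTE ij) (negbTE kj).
      exact: select_moment_j.
    apply: (zero i); rewrite jk in zero *; rewrite eqxx (negbTE ji).
    exact: select_moment_il.
  rewrite -ik in zero *; have [jl|jl] := eqVneq j l; last first.
    have lj : l != j by rewrite eq_sym.
    rewrite mul0r; apply: (zero j); rewrite eqxx (negbTE ij) (negbTE lj).
    exact: select_moment_j.
  rewrite -jl mul1r (bigD1 i)//= (bigD1 j)//= eqxx !(negbTE ij) !(negbTE ji).
  rewrite eqxx select_moment_ik select_moment_jl big1 ?mulr1//.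
  move=> m /andP[mi mj]; rewrite !(eq_sym _ m) (negbTE mi) (negbTE mj).
  exact: select_moment_none.
rewrite -ij in zero *; have [kl|kl] := eqVneq k l; last first.
  rewrite mul0r add0r.
  have lk : l != k by rewrite eq_sym.
  (* With i = j and k different from l, the index l stands alone unless it equals i, and then k
     does. *)
  have [il|il] := eqVneq i l; last first.
    rewrite !andbF !mul0r addr0; apply: (zero l).
    rewrite eqxx (negbTE il) (negbTE kl).
    exact: select_moment_l.
  rewrite -il in zero lk *; rewrite (negbTE lk) !mul0r addr0; apply: (zero k).
  by rewrite eqxx (negbTE lk) select_moment_k.
rewrite -kl in zero *; have [ik|ik] := eqVneq i k.
  rewrite -ik (bigD1 i)//= eqxx select_moment_all big1 ?mulr1.
    by rewrite rmorphD rmorph1/= ; ring.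
  by move=> m mi; rewrite !(eq_sym _ m) (negbTE mi) select_moment_none.
have ki : k != i by rewrite eq_sym.
rewrite /= !mul0r !addr0 mul1r (bigD1 i)//= (bigD1 k)//= !eqxx.
rewrite !(negbTE ik) !(negbTE ki) select_moment_ij select_moment_kl.
rewrite big1 ?mulr1//.
move=> m /andP[mi mk]; rewrite !(eq_sym _ m) (negbTE mi) (negbTE mk).
exact: select_moment_none.
Qed.

Lemma centered_mixed_cov i j :
  expectC P (fun w => z i a w * Num.conj (z j b w)) = (i == j)%:R * Sigma a b.
Proof.
have [<-|ij] := eqVneq i j; first by rewrite mul1r (centered_cov (cesx i)).
rewrite mul0r.
transitivity (\prod_m select_moment m (i == m) (j == m) false false).
  (* [pred0] leaves positions k and l free, so second moments come from the same factorisation. *)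
  rewrite -(expectC_select _ _ pred0 pred0); congr expectC; apply/funext => w.
  rewrite /select !big_split/=.
  have prod1 q (F : 'I_n -> C) : \prod_m (if q == m then F m else 1) = F q.
    by rewrite -big_mkcond (big_pred1 q)// => m; rewrite eq_sym.
  by rewrite !prod1 !big1_eq !mulr1.
by rewrite (bigD1 i)//= eqxx eq_sym (negbTE ij) select_moment_i mul0r.
Qed.

End mixed_moments.
(** The centring matrix I - J/n, with J the all-ones matrix, divided by n - 1. *)
Definition weight (i j : 'I_n) : C := (n.-1)%:R^-1 * ((i == j)%:R - n%:R^-1).

Let n0 : n%:R != 0 :> C.
Proof. by rewrite pnatr_eq0 -lt0n ltnW. Qed.

Let n10 : n.-1%:R != 0 :> C.
Proof. by rewrite pnatr_eq0 -lt0n; case: (n) n1 => [|[]]. Qed.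

Let n1E : n%:R = n.-1%:R + 1 :> C.
Proof. by rewrite natr1 prednK// ltnW. Qed.

Lemma weight_diag i : weight i i = n%:R^-1.
Proof.
rewrite /weight eqxx n1E /=; field.
by rewrite -n1E n0 n10.
Qed.

Lemma weight_conj i j : Num.conj (weight i j) = weight i j.
Proof. by rewrite rmorphM rmorphB !fmorphV !rmorph_nat. Qed.

Let sum_delta (i : 'I_n) (F : 'I_n -> C) : \sum_j (i == j)%:R * F j = F i.
Proof.
rewrite (bigD1 i)//= eqxx mul1r big1 ?addr0// => j ji.
by rewrite eq_sym (negbTE ji) mul0r.
Qed.

Lemma sum_weight_diag : \sum_i weight i i = 1.
Proof.
under eq_bigr do rewrite weight_diag.
by rewrite sumr_const card_ord -[LHS]mulr_natl divff.
Qed.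

Lemma sum_weight_diag_sqr : \sum_i weight i i * weight i i = n%:R^-1.
Proof.
under eq_bigr do rewrite weight_diag.
by rewrite sumr_const card_ord -[LHS]mulr_natl mulrA divff// mul1r.
Qed.

(** The centring matrix is a symmetric projection of trace n - 1, so its squared entries add up to n
    - 1, equally over the n rows; the weights divide this by (n - 1)^2. *)
Lemma sum_weight_sqr : \sum_i \sum_j weight i j * weight i j = n.-1%:R^-1.
Proof.
transitivity (\sum_(i < n) (n.-1%:R^-1 * n%:R^-1 : C)).
  apply: eq_bigr => i _.
  transitivity (\sum_j ((i == j)%:R * (n.-1%:R^-1 ^+ 2 * (1 - 2 / n%:R)) +
      n.-1%:R^-1 ^+ 2 * n%:R^-1 ^+ 2 : C)).
    apply: eq_bigr => j _; rewrite /weight; case: eqP => _ /=; field;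
      by rewrite n0 n10.
  rewrite big_split/= sum_delta sumr_const card_ord -[X in _ + X]mulr_natl n1E.
  by field; rewrite -n1E n0 n10.
by rewrite sumr_const card_ord -[LHS]mulr_natl mulrCA divff// mulr1.
Qed.

(** The mean [mu] cancels between an observation and the sample mean; the rest is the expansion of a
    centred sum of products. *)
Lemma sample_covE w a b : sample_cov x w a b =
  \sum_i \sum_j weight i j * (z i a w * Num.conj (z j b w)).
Proof.
rewrite /sample_cov !mxE summxE.
pose Z i := z i a w; pose Y i := Num.conj (z i b w).
have meanE c : sample_mean x w c 0 = mu c 0 + n%:R^-1 * \sum_i z i c w.
  rewrite /sample_mean mxE summxE sumrB sumr_const card_ord mulrBr.
  by rewrite -[X in _ - _ * X]mulr_natl mulKf// addrC subrK.
have centE c i : (x i w - sample_mean x w) c 0 =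
    z i c w - n%:R^-1 * \sum_j z j c w.
  by rewrite mxE [X in _ + X]mxE meanE opprD addrA.
transitivity (n.-1%:R^-1 * \sum_i (Z i - n%:R^-1 * \sum_j Z j) *
    (Y i - n%:R^-1 * \sum_j Y j)).
  congr (_ * _); apply: eq_bigr => i _.
  rewrite mxE big_ord1 centE [in X in _ * X]mxE [in X in _ * X]mxE centE.
  by rewrite rmorphB rmorphM fmorphV rmorph_nat rmorph_sum.
transitivity (n.-1%:R^-1 * (\sum_i Z i * Y i -
    n%:R^-1 * ((\sum_i Z i) * (\sum_i Y i)))).
  congr (_ * _); set s := \sum_j Z j; set t := \sum_j Y j.
  transitivity (\sum_i (Z i * Y i - Z i * (n%:R^-1 * t) -
      Y i * (n%:R^-1 * s) + n%:R^-1 ^+ 2 * (s * t))).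
    by apply: eq_bigr => i _; ring.
  rewrite big_split/= !sumrB -!mulr_suml sumr_const card_ord -/s -/t.
  by rewrite -[_ *+ n]mulr_natl; field.
transitivity (\sum_i \sum_j (n.-1%:R^-1 * ((i == j)%:R * (Z i * Y j)) -
    n.-1%:R^-1 * (n%:R^-1 * (Z i * Y j)))); last first.
  by apply: eq_bigr => i _; apply: eq_bigr => j _; rewrite /weight /Z /Y; ring.
rewrite mulr_suml mulrBr !mulr_sumr -sumrB; apply: eq_bigr => i _.
by rewrite sumrB -mulr_sumr sum_delta !mulr_sumr.
Qed.

Let intS2 a b i j : integrableC P (fun w => z i a w * Num.conj (z j b w)).
Proof. by apply: L4_integrableC2 => //; exact: L4_conj. Qed.

Let intS4 a b c e i j k l : integrableC P (fun w =>
  z i a w * Num.conj (z j b w) * Num.conj (z k c w) * z l e w).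
Proof. by apply: L4_integrableC4 => //; exact: L4_conj. Qed.

Lemma sample_cov_integrable a b : integrableC P (fun w => sample_cov x w a b).
Proof.
under eq_fun do rewrite sample_covE.
by do 2!(apply: integrableC_sum => ?); exact: integrableCZ.
Qed.

Lemma sample_cov_expect a b :
  expectC P (fun w => sample_cov x w a b) = Sigma a b.
Proof.
under eq_fun do rewrite sample_covE.
rewrite expectC_sum => [|i]; last first.
  by apply: integrableC_sum => j; exact: integrableCZ.
transitivity (\sum_i weight i i * Sigma a b).
  apply: eq_bigr => i _; rewrite expectC_sum => [|j]; last exact: integrableCZ.
  rewrite -[RHS](sum_delta i (fun j => weight i j * Sigma a b)).
  apply: eq_bigr => j _; rewrite expectCZ// (centered_mixed_cov a b a b); ring.
by rewrite -mulr_suml sum_weight_diag mul1r.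
Qed.

Let sample_cov_prodE a b c e w :
  sample_cov x w a b * Num.conj (sample_cov x w c e) =
  \sum_i \sum_j \sum_k \sum_l (weight i j * weight k l) *
    (z i a w * Num.conj (z j b w) * Num.conj (z k c w) * z l e w).
Proof.
rewrite !sample_covE rmorph_sum mulr_suml; apply: eq_bigr => i _.
rewrite mulr_suml; apply: eq_bigr => j _.
rewrite mulr_sumr; apply: eq_bigr => k _.
rewrite rmorph_sum mulr_sumr; apply: eq_bigr => l _.
by rewrite rmorphM/= weight_conj rmorphM/= conjCK; ring.
Qed.

Lemma sample_cov_prod_integrable a b c e : integrableC P
  (fun w => sample_cov x w a b * Num.conj (sample_cov x w c e)).
Proof.
under eq_fun do rewrite sample_cov_prodE.
by do 4!(apply: integrableC_sum => ?); exact: integrableCZ.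
Qed.

Lemma sample_cov_cov a b c e :
  covC P (fun w => sample_cov x w a b) (fun w => sample_cov x w c e) =
  (n.-1%:R^-1 + kappa / n%:R)%:C * (Sigma a c * Num.conj (Sigma b e)) +
  (kappa / n%:R)%:C * (Sigma a b * Num.conj (Sigma c e)).
Proof.
rewrite covCE;
  [|exact: sample_cov_integrable..|exact: sample_cov_prod_integrable].
rewrite !sample_cov_expect.
pose X := Sigma a b * Num.conj (Sigma c e).
pose Y := Sigma a c * Num.conj (Sigma b e).
(* [X] is the product of the means and is subtracted again. What remains, Y/(n-1) + kappa (X + Y)/n,
   regroups into the two coefficients of the claim. *)
suff -> : expectC P (fun w =>
      sample_cov x w a b * Num.conj (sample_cov x w c e)) =
    X + n.-1%:R^-1 * Y + n%:R^-1 * (kappa%:C * (X + Y)).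
  have tauE (k : R) : (k / n%:R)%:C = k%:C / n%:R.
    by rewrite fmorph_div rmorph_nat.
  have tau1E (k : R) : (n.-1%:R^-1 + k / n%:R)%:C = n.-1%:R^-1 + k%:C / n%:R.
    by rewrite rmorphD/= tauE fmorphV rmorph_nat.
  by rewrite tau1E tauE -/X -/Y; ring.
under eq_fun do rewrite sample_cov_prodE.
have intc i j k l :=
  integrableCZ (weight i j * weight k l) (intS4 a b c e i j k l).
have ints1 i j k := @integrableC_sum _ _ _ _ _ (index_enum 'I_n) _ (intc i j k).
have ints2 i j := @integrableC_sum _ _ _ _ _ (index_enum 'I_n) _ (ints1 i j).
have ints3 i := @integrableC_sum _ _ _ _ _ (index_enum 'I_n) _ (ints2 i).
pose K := kappa%:C * (X + Y).
transitivity (\sum_i \sum_j \sum_k \sum_l (weight i j * weight k l) *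
    (((i == j) && (k == l))%:R * X + ((i == k) && (j == l))%:R * Y +
     [&& i == j, i == k & i == l]%:R * K)).
  rewrite expectC_sum//; apply: eq_bigr => i _.
  rewrite expectC_sum//; apply: eq_bigr => j _.
  rewrite expectC_sum//; apply: eq_bigr => k _.
  rewrite expectC_sum//; apply: eq_bigr => l _.
  by rewrite expectCZ// centered_mixed_moment.
(* The sums over l, k and j are evaluated from the inside by the Kronecker deltas: the [X] term
   leaves the sum of all weights c_kk, which is 1, and the [Y] term the sum of c_ij^2 over a row. *)
transitivity (\sum_i (weight i i * X +
    (\sum_j weight i j * weight i j) * Y + weight i i * weight i i * K)).
  apply: eq_bigr => i _.
  transitivity (\sum_j
     ((i == j)%:R * (weight i j * X + weight i j * weight i i * K) +
      weight i j * weight i j * Y)).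
    apply: eq_bigr => j _.
    transitivity (\sum_k ((i == j)%:R * weight i j * X * weight k k +
        (i == k)%:R * (weight i j * weight k j * Y +
          (i == j)%:R * weight i j * weight k i * K))).
      apply: eq_bigr => k _.
      transitivity (\sum_l (
        (k == l)%:R * ((i == j)%:R * weight i j * weight k l * X) +
        (j == l)%:R * ((i == k)%:R * weight i j * weight k l * Y) +
        (i == l)%:R *
          ((i == j)%:R * (i == k)%:R * weight i j * weight k l * K))).
        by apply: eq_bigr => l _; rewrite -!mulnb !natrM; ring.
      by rewrite !big_split/= !sum_delta; ring.
    by rewrite big_split/= -mulr_sumr sum_weight_diag sum_delta; ring.
  rewrite big_split/= sum_delta -mulr_suml; ring.
rewrite !big_split/= -!mulr_suml sum_weight_diag sum_weight_sqr.
by rewrite sum_weight_diag_sqr mul1r.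
Qed.

End sample_covariance_moments.

(** * Vectorisation, the commutation matrix and traces of Hermitian matrices *)

Lemma commutation_mxE (C : nzRingType) p (k l : 'I_(p * p)) :
  commutation_mx C p k l =
  (mxtens_unindex k == ((mxtens_unindex l).2, (mxtens_unindex l).1))%:R.
Proof.
rewrite /commutation_mx summxE.
case kE : (mxtens_unindex k) => [k1 k2].
case lE : (mxtens_unindex l) => [l1 l2].
rewrite (bigD1 k1)//= [X in _ + X]big1 => [|i ik]; last first.
  rewrite summxE big1// => j _.
  by rewrite !mxE kE/= [k1 == i]eq_sym (negbTE ik) mul0r.
rewrite addr0 summxE (bigD1 k2)//= [X in _ + X]big1 => [|j jk]; last first.
  by rewrite !mxE kE/= [k2 == j]eq_sym (negbTE jk) mulr0.
rewrite addr0 !mxE kE lE/= !eqxx/= -natrM mulnb xpair_eqE.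
by rewrite andbC [l2 == _]eq_sym [l1 == _]eq_sym.
Qed.

(** K is the permutation matrix of the exchange of the two tensor indices, so right multiplication
    only relabels columns. *)
Lemma mulmx_commutation (C : nzRingType) m p (M : 'M[C]_(m, p * p)) i l :
  (M *m commutation_mx C p) i l =
  M i (mxtens_index ((mxtens_unindex l).2, (mxtens_unindex l).1)).
Proof.
rewrite mxE; set t := mxtens_index _.
rewrite (bigD1 t)//= commutation_mxE mxtens_indexK eqxx mulr1.
rewrite big1 ?addr0// => k kt; rewrite commutation_mxE.
rewrite (_ : (_ == _) = false) ?mulr0//; apply: contra_neqF kt => /eqP kE.
by rewrite /t -kE mxtens_unindexK.
Qed.

(** Column stacking puts the column index first in the pair, hence [.2] for rows and [.1] for
    columns. *)
Lemma vec_expect d (T : measurableType d) (R : realType) (P : probability T R)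
    m n (X : T -> 'M[R[i]]_(m, n)) (k : 'I_(n * m)) :
  expect_mx P (fun w => vec (X w)) k 0 =
  expectC P (fun w => X w (mxtens_unindex k).2 (mxtens_unindex k).1).
Proof. by rewrite mxE; congr expectC; apply/funext => w; rewrite mxE. Qed.

Lemma var_mxE d (T : measurableType d) (R : realType) (P : probability T R)
    m n (X : T -> 'M[R[i]]_(m, n)) (k l : 'I_(n * m)) :
  var_mx P X k l =
  covC P (fun w => X w (mxtens_unindex k).2 (mxtens_unindex k).1)
         (fun w => X w (mxtens_unindex l).2 (mxtens_unindex l).1).
Proof.
rewrite /var_mx /var_cV /cov_cV mxE; congr expectC; apply/funext => w.
rewrite mxE big_ord1 [in X in _ * X]mxE [in X in _ * X]mxE -!vec_expect.
by rewrite 2!mxE [in X in X * _]mxE 2![in X in _ * X]mxE [in X in _ * X]mxE.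
Qed.

Lemma pvar_mxE d (T : measurableType d) (R : realType) (P : probability T R)
    m n (X : T -> 'M[R[i]]_(m, n)) (k l : 'I_(n * m)) :
  let kk := mxtens_unindex k in let ll := mxtens_unindex l in
  pvar_mx P X k l =
  expectC P (fun w => (X w kk.2 kk.1 - expectC P (fun w => X w kk.2 kk.1)) *
                      (X w ll.2 ll.1 - expectC P (fun w => X w ll.2 ll.1))).
Proof.
move=> kk ll.
rewrite /pvar_mx /pvar_cV /pcov_cV mxE; congr expectC; apply/funext => w.
rewrite mxE big_ord1 [in X in _ * X]mxE -!vec_expect.
by rewrite 2!mxE [in X in X * _]mxE 2![in X in _ * X]mxE [in X in _ * X]mxE.
Qed.

Lemma sample_cov_conj d (T : measurableType d) (R : realType) n p
    (x : 'I_n -> T -> 'cV[R[i]]_p) w a b :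
  Num.conj (sample_cov x w a b) = sample_cov x w b a.
Proof.
rewrite /sample_cov !mxE !summxE rmorphM fmorphV rmorph_nat rmorph_sum.
congr (_ * _); apply: eq_bigr => i _; rewrite [in LHS]mxE [in RHS]mxE !big_ord1.
by rewrite rmorphM/= mulrC; congr (_ * _); rewrite !mxE ?conjCK.
Qed.

Lemma frobenius_sqr (R : realType) m n (A : 'M[R[i]]_(m, n)) :
  (frobenius A ^+ 2)%:C = \sum_i \sum_j A i j * Num.conj (A i j).
Proof.
rewrite /frobenius sqr_sqrtr; last first.
  by apply: sumr_ge0 => i _; apply: sumr_ge0 => j _; exact: sqr_ge0.
rewrite rmorph_sum; apply: eq_bigr => i _.
rewrite rmorph_sum; apply: eq_bigr => j _.
exact: mulC_conj_normc.
Qed.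

Section hermitian_trace.
Context (R : realType) (p : nat) (A : 'M[R[i]]_p).
Hypothesis AH : forall i j, Num.conj (A i j) = A j i.

Lemma trR_hermitian : (trR A)%:C = \tr A.
Proof.
rewrite /trR; have : Num.conj (\tr A) = \tr A.
  by rewrite rmorph_sum; apply: eq_bigr => i _; exact: AH.
by case: (\tr A) => s t /= [] /eqP; rewrite eq_sym -addr_eq0 -mulr2n
  mulrn_eq0/= => /eqP ->.
Qed.

Lemma mxtrace_mulmx_hermitian :
  \tr (A *m A) = \sum_i \sum_j A i j * Num.conj (A i j).
Proof.
by apply: eq_bigr => i _; rewrite mxE; apply: eq_bigr => j _; rewrite AH.
Qed.

Lemma frobenius_hermitian : frobenius A ^+ 2 = trR (A *m A).
Proof.
by rewrite /trR mxtrace_mulmx_hermitian -frobenius_sqr.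
Qed.

End hermitian_trace.

Section posdef_trace.
Context (R : realType) (p : nat) (A : 'M[R[i]]_p).
Hypotheses (p0 : (0 < p)%N) (pdA : posdefmx A).

Let AH i j : Num.conj (A i j) = A j i.
Proof. exact: hermsymmxE pdA.1 i j. Qed.

Lemma posdefmx_diag_gt0 i : 0 < A i i.
Proof.
have := pdA.2 (delta_mx i 0).
rewrite trmx_delta map_delta_mx -rowE -colE !mxE; apply.
by apply/eqP => /matrixP/(_ i 0)/eqP; rewrite !mxE !eqxx oner_eq0.
Qed.

(** A nonempty diagonal makes the sum strictly positive. Together with [posdefmx_trR_sqr_gt0] this
    keeps the denominators of the sphericity and of the NMSE away from 0. *)
Lemma posdefmx_trR_gt0 : 0 < trR A.
Proof.
rewrite -ltcR trR_hermitian// /mxtrace (bigD1 (Ordinal p0))//= ltr_wpDr//.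
  by apply: sumr_ge0 => i _; exact/ltW/posdefmx_diag_gt0.
exact: posdefmx_diag_gt0.
Qed.

Lemma posdefmx_trR_sqr_gt0 : 0 < trR (A *m A).
Proof.
rewrite -frobenius_hermitian// -ltcR frobenius_sqr.
pose i0 := Ordinal p0; rewrite (bigD1 i0)//= ltr_wpDr//.
  by apply: sumr_ge0 => i _; apply: sumr_ge0 => j _; exact: mul_conjC_ge0.
rewrite (bigD1 i0)//= ltr_wpDr//.
  by apply: sumr_ge0 => j _; exact: mul_conjC_ge0.
by rewrite AH mulr_gt0// posdefmx_diag_gt0.
Qed.

End posdef_trace.

Lemma finite_fourth_moments_L4 d (T : measurableType d) (R : realType)
    (P : probability T R) p (x : {RV P >-> 'cV[R[i]]_p}) :
  finite_fourth_moments P x -> forall a, L4 P (fun w => x w a 0).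
Proof.
move=> x4 a; split; first exact: RV_coord_measurable.
by have := x4 a; rewrite unlock.
Qed.

(** * Covariance, pseudo-covariance and mean squared error in matrix form *)

Section sample_covariance_second_moments.
Context d (T : measurableType d) (R : realType) (P : probability T R).
Context d' (T' : measurableType d') (Q : probability T' R) (n p : nat).
Local Notation C := R[i].
Context (r : {RV Q >-> R}) (mu : 'cV[C]_p) (Sigma : 'M[C]_p) (g : R -> R).
Context (x : 'I_n -> {RV P >-> 'cV[C]_p}).
Hypotheses (n1 : (1 < n)%N) (indx : mutually_independent x).
Hypothesis cesx : forall i, ces r mu Sigma g (x i).
Hypothesis roo : ('E_Q[fun w => (r w ^+ 4)%R] < +oo)%E.

Local Notation kappa := (elliptical_kurtosis Q r p).
Local Notation tau1 := (n.-1%:R^-1 + kappa / n%:R).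
Local Notation tau2 := (kappa / n%:R).

Let covS := sample_cov_cov n1 indx cesx roo.

Let SigmaH i j : Num.conj (Sigma i j) = Sigma j i.
Proof. exact: ces_hermitian (cesx (Ordinal n1)) i j. Qed.

Lemma sample_cov_var : var_mx P (sample_cov x) =
  tau1%:C *: (map_mx Num.conj Sigma *t Sigma) +
  tau2%:C *: (vec Sigma *m (vec Sigma)^t*).
Proof.
apply/matrixP => k l; rewrite var_mxE covS.
rewrite [in RHS]mxE; congr (_ + _); rewrite [in RHS]mxE; congr (_ * _).
  (* The first tensor index is the column of S, so the conjugated Kronecker factor pairs columns and
     the other one rows. *)
  by rewrite !mxE mulrC.
by rewrite mxE big_ord1 !mxE.
Qed.

(** S is Hermitian, so a pseudo-covariance of two entries is a covariance in which the second entry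
    has its indices exchanged, and this exchange is what K does to the columns. *)
Lemma sample_cov_pvar : pvar_mx P (sample_cov x) =
  tau1%:C *: ((map_mx Num.conj Sigma *t Sigma) *m commutation_mx _ p) +
  tau2%:C *: (vec Sigma *m (vec Sigma)^T).
Proof.
apply/matrixP => k l; rewrite pvar_mxE.
set kk := mxtens_unindex k; set ll := mxtens_unindex l.
transitivity (covC P (fun w => sample_cov x w kk.2 kk.1)
                     (fun w => sample_cov x w ll.1 ll.2)).
  congr expectC; apply/funext => w; congr (_ * _).
  rewrite rmorphB/= sample_cov_conj !(sample_cov_expect n1 indx cesx roo).
  by rewrite SigmaH.
rewrite covS [in RHS]mxE; congr (_ + _); rewrite [in RHS]mxE; congr (_ * _).
  by rewrite mulmx_commutation !mxE mxtens_indexK/= mulrC.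
by rewrite mxE big_ord1 !mxE SigmaH.
Qed.

(** S is unbiased, so the MSE is the sum of the variances of its entries. For (c, e) = (a, b) the
    first term of [sample_cov_cov] is Sigma_aa Sigma_bb, which sums to the squared trace. *)
Lemma sample_cov_mse : mse P (sample_cov x) Sigma =
  (tau1 * trR Sigma ^+ 2 + tau2 * trR (Sigma *m Sigma))%:E.
Proof.
pose D a b w := sample_cov x w a b - Sigma a b.
(* Finiteness has to be shown here, because [mse] is an extended real. *)
have intD a b : integrableC P (fun w => D a b w * Num.conj (D a b w)).
  have intS := sample_cov_integrable n1 cesx roo.
  have -> : (fun w => D a b w * Num.conj (D a b w)) = (fun w =>
      sample_cov x w a b * Num.conj (sample_cov x w a b) -
      Num.conj (Sigma a b) * sample_cov x w a b -
      (Sigma a b * Num.conj (sample_cov x w a b) -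
       Sigma a b * Num.conj (Sigma a b))).
    by apply/funext => w; rewrite /D rmorphB/=; ring.
  apply: integrableCB.
    apply: integrableCB; first exact: (sample_cov_prod_integrable n1 cesx roo).
    exact: integrableCZ.
  apply: integrableCB; last exact: integrableC_cst.
  exact/integrableCZ/integrableC_conj.
have frobE w : (frobenius (sample_cov x w - Sigma) ^+ 2)%:C =
    \sum_a \sum_b D a b w * Num.conj (D a b w).
  rewrite frobenius_sqr; apply: eq_bigr => a _; apply: eq_bigr => b _.
  have -> : (sample_cov x w - Sigma) a b = D a b w; last by [].
  by rewrite mxE [X in _ + X]mxE.
have intf :
    integrableC P (fun w => (frobenius (sample_cov x w - Sigma) ^+ 2)%:C).
  under eq_fun do rewrite frobE.
  by apply: integrableC_sum => a; exact: integrableC_sum.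
rewrite /mse expectC_real; last by case: intf.
under [X in expectC P X]eq_fun do rewrite frobE.
rewrite expectC_sum => [|a]; last exact: integrableC_sum.
suff -> : \sum_a expectC P (fun w => \sum_b D a b w * Num.conj (D a b w)) =
    (tau1 * trR Sigma ^+ 2 + tau2 * trR (Sigma *m Sigma))%:C by [].
transitivity (\sum_a \sum_b (tau1%:C * (Sigma a a * Sigma b b) +
    tau2%:C * (Sigma a b * Num.conj (Sigma a b)))).
  apply: eq_bigr => a _; rewrite expectC_sum//; apply: eq_bigr => b _.
  rewrite -(SigmaH b b) -covS; congr expectC.
  by apply/funext => w; rewrite (sample_cov_expect n1 indx cesx roo).
have realE (s t v y : R) :
    (s * t ^+ 2 + v * y)%:C = s%:C * t%:C ^+ 2 + v%:C * y%:C.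
  by rewrite rmorphD !rmorphM.
rewrite -(frobenius_hermitian SigmaH) realE frobenius_sqr trR_hermitian//.
under eq_bigr do rewrite big_split/= -!mulr_sumr.
rewrite big_split/= -!mulr_sumr; congr (_ * _ + _).
by rewrite expr2 [in RHS]/mxtrace mulr_suml.
Qed.

End sample_covariance_second_moments.

Theorem theorem3 (R : realType) (n p : nat)
    (d : measure_display) (T : measurableType d) (P : probability T R)
    (d' : measure_display) (T' : measurableType d') (Q : probability T' R)
    (r : {RV Q >-> R}) (mu : 'cV[R[i]]_p) (Sigma : 'M[R[i]]_p) (g : R -> R)
    (x : 'I_n -> {RV P >-> 'cV[R[i]]_p}) :
  (1 < n)%N -> (0 < p)%N -> density_generator g ->
  mutually_independent x ->
  (forall i, ces r mu Sigma g (x i)) ->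
  (forall i, finite_fourth_moments P (x i)) ->
  let S := sample_cov x in
  let kappa := elliptical_kurtosis Q r p in
  let tau1 := (n.-1)%:R^-1 + kappa / n%:R in
  let tau2 := kappa / n%:R in
  [/\ var_mx P S =
        tau1%:C *: (map_mx Num.conj Sigma *t Sigma) +
        tau2%:C *: (vec Sigma *m (vec Sigma)^t*),
      pvar_mx P S =
        tau1%:C *: ((map_mx Num.conj Sigma *t Sigma) *m commutation_mx _ p) +
        tau2%:C *: (vec Sigma *m (vec Sigma)^T),
      (forall (d0 : measure_display) (T0 : measurableType d0)
          (P0 : probability T0 R) (y : 'I_n -> {RV P0 >-> 'cV[R[i]]_p})
          (hp : (1 < p)%N),
        mutually_independent y -> (forall i, ces r 0 1%:M g (y i)) ->
        let S0 := sample_cov y in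
        let i1 := Ordinal (ltnW hp) in
        let i2 := Ordinal hp in
        varC P0 (fun w => S0 w i1 i2) = tau1%:C /\
        covC P0 (fun w => S0 w i1 i1) (fun w => S0 w i2 i2) = tau2%:C),
      mse P S Sigma =
        (tau1 * trR Sigma ^+ 2 + tau2 * trR (Sigma *m Sigma))%:E &
      nmse P S Sigma = (p%:R / sphericity Sigma * tau1 + tau2)%:E].
Proof.
move=> n1 p0 _ indx cesx x4 S kappa tau1 tau2.
have i0 : 'I_n := Ordinal n1.
have roo := ces_radius_finite (cesx i0) (finite_fourth_moments_L4 (x4 i0)).
have pdS := ces_scatter (cesx i0).
have SH := hermsymmxE pdS.1.
have mseS : mse P S Sigma =
    (tau1 * trR Sigma ^+ 2 + tau2 * trR (Sigma *m Sigma))%:E.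
  exact: (sample_cov_mse n1 indx cesx roo).
split.
- exact: (sample_cov_var n1 indx cesx roo).
- exact: (sample_cov_pvar n1 indx cesx roo).
- move=> d0 T0 P0 y hp indy cesy S0 i1 i2.
  (* [roo], obtained from [x], applies to [y] because [r] is shared. At Sigma = I, s_12 with itself
     keeps only the term Sigma_ac Sigma_be^*, and s_11 with s_22 only Sigma_ab Sigma_ce^*. *)
  have covS0 := sample_cov_cov n1 indy cesy roo.
  split; rewrite ?/varC covS0 !mxE /= ?conjC0 ?conjC1;
    by rewrite ?mulr0 ?mulr1 ?addr0 ?add0r.
- exact: mseS.
- rewrite /nmse mseS -EFinM frobenius_hermitian//; congr EFin.
  have tr0 := lt0r_neq0 (posdefmx_trR_gt0 p0 pdS).
  have trS0 := lt0r_neq0 (posdefmx_trR_sqr_gt0 p0 pdS).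
  by rewrite /sphericity; field; rewrite tr0 trS0 pnatr_eq0 -lt0n p0.
Qed.
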